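(* Let $w_1,\dots,w_r\in L^1_{\mathcal L,\Sigma}(\mathbb{R})$ and suppose that the Laplace transforms $\mathcal{L}w_j$ are analytic at the origin. If, for all $m\in\{1,\dots,n\}$, the functions in $\mathcal W(m;w_1,\dots,w_r)$ are of additive derivative type, then the type II polynomial with respect to $(w_1,\dots,w_r)$ for the multi-index $\vec n\in\mathcal S^r$ with $|\vec n|=n$ is given by $$P_{\vec n}(x)=\mathcal{L}\omega_{2,n}(0)\sum_{k=0}^{|\vec n|}(-1)^{|\vec n|-k}\binom{|\vec n|}{k}\left(\frac{1}{\mathcal{L}\omega_{2,n}}\right)^{(|\vec n|-k)}(0)\,x^k,$$ where $\omega_{2,n}$ is the function with respect to which the functions in $\mathcal W(n;w_1,\dots,w_r)$ are of additive derivative type, and its Laplace transform is of the form $$\mathcal{L}\omega_{2,n}(s)=\exp\left(c\int_{s_0}^s\prod_{i=1}^r\frac{(t+a_i)^{d_1(i)}}{(t+b_i)^{d_2(i)}}dt\right)\frac{1}{\prod_{i=1}^r(s+b_i)^{d_2(i)n_i}},\qquad s\in\Sigma,$$ for some $a_i\in\mathbb{C}$, $b_i,c,s_0\in\mathbb{R}$ and $d_1,d_2:\{1,\dots,r\}\to\{0,1\}$ with all $d_1(i)=1$ or all $d_2(i)=1$.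
   Context: $\Sigma\subset\mathbb{R}_{>0}$ is an interval, $L^1_{\mathcal L,\Sigma}(\mathbb{R})=\{f:\mathbb{R}\to\mathbb{C}\mid\int_{-\infty}^\infty|f(x)e^{-sx}|dx<\infty,\ s\in\Sigma\}$, and $\mathcal{L}f(s)=\int_{-\infty}^\infty f(x)e^{-sx}dx$ is the (bilateral) Laplace transform. The weights $w_j$ are real-valued. The role of analyticity of the $\mathcal{L}w_j$ at the origin is to ensure that all moments of the $w_j$ exist. Step-line: $\mathcal S^r=\{\vec n\in\mathbb{Z}_{\ge0}^r\mid n_1\ge\dots\ge n_r\ge n_1-1\}$, $|\vec n|=n_1+\dots+n_r$; for each $m$ there is a unique $\vec m\in\mathcal S^r$ with $|\vec m|=m$. $\mathcal W(m;w_1,\dots,w_r)$ denotes the collection of the $m$ functions $x\mapsto x^{k-1}w_j(x)$, $k=1,\dots,m_j$, $j=1,\dots,r$, for this $\vec m$. Functions $v_1,\dots,v_m:\mathbb{R}\to\mathbb{R}$ are of additive derivative type with respect to a function $\omega\in C^{m-2}(\mathbb{R})$, with $\omega^{(m-2)}$ locally absolutely continuous on $\mathbb{R}$ (no regularity condition if $m=1$), if $\mathrm{span}\{v_j(x)\}_{j=1}^m=\mathrm{span}\{\omega^{(j-1)}(x)\}_{j=1}^m$ for a.e. $x\in\mathbb{R}$; they are of additive derivative type if this holds for some such $\omega$. The type II (multiple orthogonal) polynomial with respect to $(w_1,\dots,w_r)$ for $\vec n$ is the monic polynomial $P_{\vec n}$ of degree $|\vec n|$ satisfying $\int_{-\infty}^\infty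 P_{\vec n}(x)x^kw_j(x)dx=0$ for $k\in\{0,\dots,n_j-1\}$, $j\in\{1,\dots,r\}$.
   Formalization: The form of Lω_{2,n} is claimed only for n > r, with Lω_{2,n} nonzero on Σ and ω_{2,n} rescaled by a nonzero real constant (false otherwise); the formula for P is stated as equivalent: P is the unique type II polynomial iff Lω_{2,n}(0) ≠ 0 and P is given by it. *)

(* Defs.v *)
From HB Require Import structures.
From mathcomp Require Import all_boot all_order all_algebra.
From mathcomp Require Import all_classical all_reals all_analysis.
From mathcomp Require Export complex.
Export numFieldNormedType.Exports.

Set Implicit Arguments.
Unset Strict Implicit.
Unset Printing Implicit Defensive.

Import Order.TTheory GRing.Theory Num.Theory.

Local Open Scope classical_set_scope.
Local Open Scope ring_scope.
Local Open Scope complex_scope.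

Section Laplace.
Context {R : realType}.
Local Notation mu := (@lebesgue_measure R).

Definition L1_Laplace (Sigma : set R) (f : R -> R) : Prop :=
  forall s, Sigma s ->
    mu.-integrable setT (EFin \o (fun x => f x * expR (- (s * x)))).

Definition Laplace (f : R -> R) (s : R) : R :=
  \int[mu]_x (f x * expR (- (s * x))).

(* The defining integral itself, and not merely an analytic continuation of
   its values elsewhere, exists near 0: otherwise f may fail to have moments
   (the transform s / (s ^ 2 + 1) of cos on the half-line is regular at 0). *)
Definition Laplace_analytic_at0 (f : R -> R) : Prop :=
  exists2 d : R, 0 < d &
    L1_Laplace [set s | `|s| < d] f /\
    exists a : nat -> R, forall s, `|s| < d ->
      series (fun k => a k * s ^+ k) @ \oo --> Laplace f s.

End Laplace.

Section AdditiveDerivativeType.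
Context {R : realType}.
Local Notation mu := (@lebesgue_measure R).

Definition absolutely_continuous (a b : R) (f : R -> R) : Prop :=
  forall e : R, 0 < e -> exists2 d : R, 0 < d &
    forall (N : nat) (u v : 'I_N -> R),
      (forall i, a <= u i /\ u i <= v i /\ v i <= b) ->
      (forall i j, i != j -> v i <= u j \/ v j <= u i) ->
      \sum_i (v i - u i) < d -> \sum_i `|f (v i) - f (u i)| < e.

Definition locally_absolutely_continuous (f : R -> R) : Prop :=
  forall a b : R, a <= b -> absolutely_continuous a b f.

Definition class_C (k : nat) (f : R -> R) : Prop :=
  (forall j, (j < k)%N -> forall x, derivable (derive1n j f) x 1) /\
  continuous (derive1n k f).

(* Spans of functions, functions being identified when they agree a.e. *)
Definition in_span (I : finType) (v : I -> R -> R) (f : R -> R) : Prop :=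
  exists c : I -> R, {ae mu, forall x, f x = \sum_i c i * v i x}.

(* The derivative of order #|I| - 1 exists only a.e.; the junk values of
   derive1n on the exceptional null set do not affect the a.e. span. *)
Definition additive_derivative_type_wrt (I : finType) (v : I -> R -> R)
    (omega : R -> R) : Prop :=
  ((2 <= #|I|)%N ->
     class_C (#|I| - 2) omega /\
     locally_absolutely_continuous (derive1n (#|I| - 2) omega)) /\
  (forall f, in_span v f <->
     in_span (fun j : 'I_#|I| => derive1n j omega) f).

Definition additive_derivative_type (I : finType) (v : I -> R -> R) : Prop :=
  exists omega, additive_derivative_type_wrt v omega.

End AdditiveDerivativeType.

Section StepLine.
Context {r : nat}.

Definition mi_norm (nv : 'I_r -> nat) : nat := (\sum_j nv j)%N.

Definition step_line (nv : 'I_r -> nat) : Prop :=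
  forall i j : 'I_r, (i <= j)%N -> (nv j <= nv i <= (nv j).+1)%N.

(* The collection W(|mv|; w_1, ..., w_r), as a family of |mv| functions; the
   index (j, k) stands for x^k w_j(x) with 0 <= k < mv_j. *)
Definition W_family {R : realType} (w : 'I_r -> R -> R) (mv : 'I_r -> nat)
    (jk : {j : 'I_r & 'I_(mv j)}) : R -> R :=
  fun x => x ^+ tagged jk * w (tag jk) x.

Definition typeII_conditions {R : realType} (w : 'I_r -> R -> R)
    (nv : 'I_r -> nat) (P : {poly R}) : Prop :=
  [/\ P \is monic, size P = (mi_norm nv).+1 &
      forall (j : 'I_r) (k : nat), (k < nv j)%N ->
        \int[@lebesgue_measure R]_x (P.[x] * x ^+ k * w j x) = 0].

Definition is_typeII_polynomial {R : realType} (w : 'I_r -> R -> R)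
    (nv : 'I_r -> nat) : {poly R} -> Prop :=
  unique (typeII_conditions w nv).

End StepLine.

Section ComplexAnalysis.
Context {R : realType}.
Local Notation mu := (@lebesgue_measure R).

Definition cexp (z : R[i]) : R[i] :=
  (expR (complex.Re z) * cos (complex.Im z)) +i*
  (expR (complex.Re z) * sin (complex.Im z)).

Definition oriented_integral (a b : R) (g : R -> R) : R :=
  if a <= b then \int[mu]_(t in `[a, b]) g t
  else - \int[mu]_(t in `[b, a]) g t.

Definition c_oriented_integral (a b : R) (g : R -> R[i]) : R[i] :=
  oriented_integral a b (fun t => complex.Re (g t)) +i*
  oriented_integral a b (fun t => complex.Im (g t)).

Definition c_integrable_between (a b : R) (g : R -> R[i]) : Prop :=
  let D := `[Num.min a b, Num.max a b] in
  mu.-integrable [set` D] (EFin \o (fun t => complex.Re (g t))) /\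
  mu.-integrable [set` D] (EFin \o (fun t => complex.Im (g t))).

(* d1 i, d2 i : bool are used as exponents in {0, 1}. *)
Definition rational_product (r : nat) (a : 'I_r -> R[i]) (b : 'I_r -> R)
    (d1 d2 : 'I_r -> bool) (t : R) : R[i] :=
  \prod_i ((t%:C + a i) ^+ d1 i / (t%:C + (b i)%:C) ^+ d2 i).

End ComplexAnalysis.

Arguments W_family {r R} w mv jk _.

(* Main.v *)
From HB Require Import structures.
From mathcomp Require Import all_boot all_order all_algebra.
From mathcomp Require Import all_classical all_reals all_analysis.
From mathcomp Require Import measurable_realfun ring lra zify finmap.
Require Import Defs.

(** Under the Laplace transform [L], a family of additive derivative type becomes a
    space of polynomials. If [om] generates the family with [m] members, then
    [L om^(j) = s^j L om] for [j < m], so the transforms of the span are the products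
    of [L om] with the polynomials of degree less than [m]. The identity
    [L f' = s L f] is the analytic core ([Laplace_derivative]). Since the last
    derivative comes from a function that is only absolutely continuous, it needs
    the fundamental theorem of calculus in that generality: an absolutely
    continuous function is a difference of monotone ones, whose Stieltjes measures
    are dominated by Lebesgue measure, and the Radon-Nikodym densities are recovered
    by Lebesgue differentiation ([absolutely_continuous_density]).

    For the type II polynomial, orthogonality of [P] to the family amounts to
    orthogonality to the derivatives of [om], and integration by parts moves the
    derivatives to [P]: the functional [p |-> \int p om] has to vanish at [P], [P'],
    up to the derivative of order [n - 1]. This determines a monic [P] exactly when
    [L om 0 <> 0] (otherwise constants may be added), and the solution is the Appell
    polynomial whose coefficients are the derivatives at zero of the reciprocal of
    [L om] ([appell_unique], [derive1n_inv], [typeII_appell]).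

    For the shape of [F = L om], let the generator of the family with [m] members
    have transform [E m * F], with [E m] a polynomial. As the families increase with
    [m], [E m = p * E (m + 1)] with [p] of degree at most one ([downward_chain]), so
    [q = E (n - r)] has degree at most [r] and only real roots. Multiplication by [x]
    maps the span for [n - r] into the span for [n] and acts as [- d/ds] on
    transforms, which gives [q F' = P F] with [P] of degree at most [r]
    ([log_derivative_fraction]). A root of [q] in [Sigma] is also a root of [P],
    because a pole of [F' / F] is incompatible with [F] being continuous and
    nonzero there ([pole_not_in_Sigma]); such roots are cancelled. The remaining
    fraction may be expanded by powers of [s + 1], and multiplying [F] by
    [\prod_i (s + b i) ^+ n i] only changes its numerator; this yields the
    prescribed degrees, and integrating the logarithmic derivative of the product
    yields the formula ([log_derivative_closed_form]). *)

Set Implicit Arguments.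
Unset Strict Implicit.
Unset Printing Implicit Defensive.

Import Order.TTheory GRing.Theory Num.Theory.
Import numFieldNormedType.Exports.

Local Open Scope classical_set_scope.
Local Open Scope ring_scope.

(** * Total variation along families of separated intervals *)

Section IntervalFamilies.
Context {R : realType}.
Implicit Types (s : seq (R * R)) (f : R -> R).

Definition sep_itv (p q : R * R) := (p.2 <= q.1) || (q.2 <= p.1).

Definition itv_in (a b : R) (p : R * R) := [&& a <= p.1, p.1 <= p.2 & p.2 <= b].

Definition total_length s := \sum_(p <- s) (p.2 - p.1).

(** The same modulus of continuity for lists of intervals: refining a list is an
    append, whereas refining a family indexed by ordinals would mean
    reindexing. *)
Lemma absolutely_continuous_seq (a b : R) f :
  Defs.absolutely_continuous a b f ->
  forall e : R, 0 < e -> exists2 d : R, 0 < d &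
    forall s, all (itv_in a b) s -> pairwise sep_itv s -> total_length s < d ->
      \sum_(p <- s) `|f p.2 - f p.1| < e.
Proof.
move=> acf e e0; have [d d0 H] := acf e e0; exists d => // s ins seps lens.
have sz (i : 'I_(size s)) : (i < size s)%N by [].
have E (F : R * R -> R) :
    \sum_(p <- s) F p = \sum_(i < size s) F (nth (0, 0) s i).
  by rewrite (big_nth (0, 0)) big_mkord.
rewrite E.
apply: (H _ (fun i => (nth (0, 0) s i).1) (fun i => (nth (0, 0) s i).2)).
- move=> i; have /allP/(_ (nth (0, 0) s i)) := ins.
  by move=> /(_ (mem_nth _ (sz i))) /and3P[].
- move=> i j ij.
  have /(pairwiseP (0, 0)) sepP := seps.
  have := ij; rewrite neq_ltn => /orP[lij|lji].
    by have /orP[] := sepP i j (sz i) (sz j) lij; [left|right].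
  by have /orP[] := sepP j i (sz j) (sz i) lji; [right|left].
- by move: lens; rewrite /total_length E.
Qed.

Definition partition_pairs (u : R) (t : seq R) :=
  [seq (x.2, x.1) | x <- zip t (u :: t)].

Lemma partition_pairs_cons u x t :
  partition_pairs u (x :: t) = (u, x) :: partition_pairs x t.
Proof. by []. Qed.

Lemma sum_partition_pairs f u v t : itv_partition u v t ->
  \sum_(p <- partition_pairs u t) `|f p.2 - f p.1| = variation u v f t.
Proof. by move=> uvt; rewrite big_map /= (variation_zip _ uvt). Qed.

Lemma partition_pairsP u v t : itv_partition u v t ->
  [/\ all (itv_in u v) (partition_pairs u t),
      pairwise sep_itv (partition_pairs u t) &
      total_length (partition_pairs u t) = v - u].
Proof.
elim: t u => [u /itv_partition_nil ->|x t ih u uvt].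
  by rewrite /total_length big_nil subrr.
have xvt := itv_partition_cons uvt.
have [inx sepx lenx] := ih _ xvt.
have ux : u <= x by have := uvt; rewrite /itv_partition /= => -[/andP[/ltW]].
have xv : x <= v by exact: itv_partition_le xvt.
rewrite partition_pairs_cons; split.
- rewrite /= /itv_in /= lexx ux xv /=.
  by apply: sub_all inx => p /and3P[xp -> ->]; rewrite (le_trans ux xp).
- rewrite /= sepx andbT; apply: sub_all inx => p /and3P[xp _ _].
  by rewrite /sep_itv /= xp.
- by rewrite /total_length big_cons -/(total_length _) lenx /=; lra.
Qed.

Lemma sep_itvC p q : sep_itv p q = sep_itv q p.
Proof. by rewrite /sep_itv orbC. Qed.

Lemma sep_itv_sub p q q' : itv_in q.1 q.2 q' -> sep_itv p q -> sep_itv p q'.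
Proof.
move=> /and3P[h1 _ h2] /orP[h|h]; apply/orP; [left|right].
  exact: le_trans h h1.
exact: le_trans h2 h.
Qed.

Lemma total_length_cat s s' :
  total_length (s ++ s') = total_length s + total_length s'.
Proof. by rewrite /total_length big_cat. Qed.

(** The heart of the absolute continuity of the total variation: subdividing
    each interval of a family changes neither its separation nor its total
    length, so the bound on the increments passes to the supremum over all
    subdivisions. *)
Lemma sum_total_variation_le (a b : R) f (d e : R) :
  (forall s, all (itv_in a b) s -> pairwise sep_itv s -> total_length s < d ->
      \sum_(p <- s) `|f p.2 - f p.1| < e) ->
  forall s, all (itv_in a b) s -> pairwise sep_itv s -> total_length s < d ->
    (\sum_(p <- s) total_variation p.1 p.2 f <= e%:E)%E.
Proof.
move=> H s.
(* The intervals of [s1] have already been subdivided, those of [s] not yet. *)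
suff main s1 : all (itv_in a b) (s ++ s1) -> pairwise sep_itv (s ++ s1) ->
   total_length (s ++ s1) < d ->
   ((\sum_(p <- s1) `|f p.2 - f p.1|)%:E +
    \sum_(p <- s) total_variation p.1 p.2 f <= e%:E)%E.
  move=> ins seps lens; have := main [::]; rewrite cats0 => /(_ ins seps lens).
  by rewrite big_nil add0e.
elim: s s1 => [s1 /= ? ? ?|p s ih s1].
  by rewrite big_nil adde0 lee_fin ltW// H.
rewrite big_cons cat_cons.
move=> /= /andP[inp ins] /andP[sepp seps] lens.
have p12 : p.1 <= p.2 by case/and3P: inp.
have [inap _ inpb] := and3P inp.
set r := (\sum_(q <- s) _)%E.
have r0 : (0 <= r)%E.
  rewrite /r big_seq; apply: sume_ge0 => q qs; apply: total_variation_ge0.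
  move: ins; rewrite all_cat => /andP[/allP/(_ q qs)/and3P[]//].
have rle : ((\sum_(q <- s1) `|f q.2 - f q.1|)%:E + r <= e%:E)%E.
  apply: ih => //.
  by move: lens; rewrite /total_length big_cons; lra.
have rfin : r \is a fin_num.
  by rewrite ge0_fin_numE// ltey; apply/eqP => rE; move: rle; rewrite rE.
clear rle; move: (fineK rfin) => rE; rewrite -rE.
rewrite addeCA -EFinD -leeBrDr // -EFinB.
apply: ge_ereal_sup => _ [_ [t pt <-] <-].
rewrite lee_fin lerBrDr -lee_fin.
have [inpt seppt lenpt] := partition_pairsP pt.
have := ih (partition_pairs p.1 t ++ s1).
rewrite big_cat /= (sum_partition_pairs _ pt) -/r -rE -!EFinD addrA.
apply.
- rewrite all_cat all_cat; move: ins; rewrite all_cat => /andP[-> ->].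
  rewrite andbT /=; apply: sub_all inpt => q /and3P[h1 h2 h3].
  by apply/and3P; split=> //; [exact: le_trans h1|exact: le_trans inpb].
- rewrite !pairwise_cat; move: seps; rewrite pairwise_cat => /and3P[h1 h2 h3].
  move: sepp; rewrite all_cat => /andP[ps ps1].
  have sub q q' : q' \in partition_pairs p.1 t -> sep_itv p q -> sep_itv q q'.
    move=> q'in; rewrite sep_itvC; move=> h; apply: sep_itv_sub h.
    exact: (allP inpt).
  rewrite h2 h3 seppt /= andbT allrel_catr h1 andbT; apply/andP; split.
    by apply/allrelP => q q' qs q't; apply: sub q't (allP ps _ qs).
  apply/allrelP => q' q q't qs; rewrite sep_itvC.
  exact: sub q't (allP ps1 _ qs).
- rewrite !total_length_cat lenpt; move: lens.
  by rewrite /total_length big_cons big_cat /=; lra.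
Qed.

End IntervalFamilies.

(** * Monotone pieces of an absolutely continuous function *)

Section JordanDecomposition.
Context {R : realType}.
Implicit Types (s : seq (R * R)) (f : R -> R).

(** Freezing a function outside [a, b] turns it into a function on the whole
    line without affecting monotonicity or absolute continuity; Stieltjes
    measures are built from functions on the line. *)
Definition clamp (a b x : R) := Num.max a (Num.min b x).

Lemma clamp_in a b x : a <= b -> a <= clamp a b x <= b.
Proof.
by move=> ab; rewrite /clamp le_max lexx ge_max ab ge_min lexx.
Qed.

Lemma clamp_id a b x : a <= x <= b -> clamp a b x = x.
Proof. by case/andP=> ax xb; rewrite /clamp (min_idPr xb) (max_idPr ax). Qed.

Lemma clamp_le a b x y : x <= y -> clamp a b x <= clamp a b y.
Proof.
move=> xy; rewrite /clamp; have [?|?] := leP b x; have [?|?] := leP b y;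
  have [?|?] := leP a b; have [?|?] := leP a x; have [?|?] := leP a y; lra.
Qed.

Lemma clamp_lip a b x y : x <= y -> clamp a b y - clamp a b x <= y - x.
Proof.
move=> xy; rewrite /clamp; have [?|?] := leP b x; have [?|?] := leP b y;
  have [?|?] := leP a b; have [?|?] := leP a x; have [?|?] := leP a y; lra.
Qed.

Definition monotone_ac (g : R -> R) := forall e : R, 0 < e ->
  exists2 d : R, 0 < d & forall s, all (fun p => p.1 <= p.2) s ->
    pairwise sep_itv s -> total_length s < d ->
    \sum_(p <- s) (g p.2 - g p.1) <= e.

Lemma monotone_ac_clamp a b (h : R -> R) : a <= b ->
  (forall e : R, 0 < e -> exists2 d : R, 0 < d & forall s, all (itv_in a b) s ->
    pairwise sep_itv s -> total_length s < d ->
    \sum_(p <- s) (h p.2 - h p.1) <= e) ->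
  monotone_ac (h \o clamp a b).
Proof.
move=> ab H e e0; have [d d0 {}H] := H e e0; exists d => // s s12 seps lens.
pose t := [seq (clamp a b p.1, clamp a b p.2) | p <- s].
have := H t; rewrite big_map /=; apply.
- apply/allP => _ /mapP[p ps ->]; rewrite /itv_in /=.
  have /andP[-> _] := clamp_in p.1 ab; have /andP[_ ->] := clamp_in p.2 ab.
  by rewrite clamp_le//; exact: (allP s12).
- rewrite /t pairwise_map; apply: sub_pairwise seps => p q /=.
  by rewrite /sep_itv /= => /orP[/(clamp_le a b)->//|/(clamp_le a b)->];
    rewrite ?orbT.
- apply: le_lt_trans lens; rewrite /total_length big_map /= !big_seq.
  by apply: ler_sum => p ps; apply: clamp_lip; exact: (allP s12).
Qed.

Section fixed.
Variables (a b : R) (f : R -> R).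
Hypotheses (ab : a <= b) (acf : Defs.absolutely_continuous a b f).

Lemma absolutely_continuous_TV e : 0 < e ->
  exists2 d : R, 0 < d & forall s, all (itv_in a b) s -> pairwise sep_itv s ->
    total_length s < d ->
    (\sum_(p <- s) total_variation p.1 p.2 f <= e%:E)%E.
Proof.
move=> e0; have [d d0 H] := absolutely_continuous_seq acf e0.
by exists d => //; exact: sum_total_variation_le.
Qed.

(** A short interval has variation at most one, and every segment is covered by
    finitely many short ones. *)
Lemma absolutely_continuous_TV_fin x y : a <= x -> x <= y -> y <= b ->
  total_variation x y f \is a fin_num.
Proof.
have [d d0 H] := absolutely_continuous_TV ltr01.
have short u v : a <= u -> u <= v -> v <= b -> v - u < d ->
    total_variation u v f \is a fin_num.
  move=> au uv vb uvd; rewrite ge0_fin_numE ?total_variation_ge0//.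
  have := H [:: (u, v)]; rewrite /total_length !big_seq1 /= /itv_in /=.
  by rewrite au uv vb => /(_ erefl erefl uvd)/le_lt_trans; apply; rewrite ltry.
have long k u v : a <= u -> u <= v -> v <= b -> v - u < k%:R * (d / 2) ->
    total_variation u v f \is a fin_num.
  elim: k u v => [u v|k ih u v au uv vb].
    by rewrite mul0r; lra.
  rewrite -natr1 mulrDl mul1r => uvk.
  have [uvd|uvd] := ltP (v - u) d; first exact: short.
  have h1 : u <= u + d / 2 by lra.
  have h2 : u + d / 2 <= v by lra.
  rewrite (total_variationD f h1 h2) fin_numD; apply/andP; split.
    by apply: short; lra.
  by apply: ih; lra.
move=> ax xy yb.
apply: (long (Num.bound ((y - x) / (d / 2)))) => //.
rewrite -ltr_pdivrMr ?divr_gt0//.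
have yx0 : 0 <= (y - x) / (d / 2) by rewrite divr_ge0 ?subr_ge0// ltW// divr_gt0.
by have := archi_boundP yx0.
Qed.

Definition tv (x : R) : R := fine (total_variation a x f).

Lemma tvB x y : a <= x -> x <= y -> y <= b ->
  total_variation x y f = (tv y - tv x)%:E.
Proof.
move=> ax xy yb; rewrite /tv (total_variationD f ax xy).
rewrite fineD ?absolutely_continuous_TV_fin//; last exact: le_trans yb.
rewrite addrAC subrr add0r fineK// absolutely_continuous_TV_fin//.
Qed.

Lemma tv_ge x y : a <= x -> x <= y -> y <= b -> `|f y - f x| <= tv y - tv x.
Proof.
by move=> ax xy yb; rewrite -lee_fin -tvB// total_variation_ge.
Qed.

Lemma monotone_ac_tv : monotone_ac (tv \o clamp a b).
Proof.
apply: monotone_ac_clamp => // e e0.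
have [d d0 H] := absolutely_continuous_TV e0; exists d => // s ins seps lens.
rewrite -lee_fin -sumEFin; apply: le_trans (H s ins seps lens).
rewrite !big_seq le_eqVlt; apply/orP; left; apply/eqP; apply: eq_bigr => p ps.
by have /and3P[? ? ?] := allP ins _ ps; rewrite tvB.
Qed.

(** With [monotone_ac_tv], this writes [f] as a difference of two monotone
    absolutely continuous functions: an increment of [f] is dominated by the
    variation, hence an increment of [tv - f] by twice the variation. *)
Lemma monotone_ac_tvB : monotone_ac ((tv \- f) \o clamp a b).
Proof.
apply: monotone_ac_clamp => // e e0.
have [d d0 H] := absolutely_continuous_TV (divr_gt0 e0 (ltr0n _ 2)).
exists d => // s ins seps lens.
have E : \sum_(p <- s) (tv p.2 - tv p.1) <= e / 2.
  rewrite -lee_fin -sumEFin; apply: le_trans (H s ins seps lens).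
  rewrite !big_seq le_eqVlt; apply/orP; left; apply/eqP; apply: eq_bigr => p ps.
  by have /and3P[? ? ?] := allP ins _ ps; rewrite tvB.
apply: (@le_trans _ _ (\sum_(p <- s) ((tv p.2 - tv p.1) *+ 2))).
  rewrite !big_seq; apply: ler_sum => p ps.
  have /and3P[? ? ?] := allP ins _ ps.
  have := @tv_ge p.1 p.2; rewrite ler_norml => H'.
  by have /andP[] := H' ltac:(done) ltac:(done) ltac:(done); rewrite /=; lra.
by rewrite sumrMnl; lra.
Qed.

Lemma tv_clamp_nd : {homo (tv \o clamp a b) : x y / x <= y}.
Proof.
move=> x y xy /=; have /andP[h1 h2] := clamp_in x ab.
have /andP[h3 h4] := clamp_in y ab.
have := tv_ge h1 (clamp_le a b xy) h4.
by move/(le_trans (normr_ge0 _)); rewrite subr_ge0.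
Qed.

Lemma tvB_clamp_nd : {homo ((tv \- f) \o clamp a b) : x y / x <= y}.
Proof.
move=> x y xy /=; have /andP[h1 h2] := clamp_in x ab.
have /andP[h3 h4] := clamp_in y ab.
have := tv_ge h1 (clamp_le a b xy) h4.
by move/(le_trans (ler_norm _)); lra.
Qed.

End fixed.

Lemma monotone_ac_continuous (g : R -> R) : {homo g : x y / x <= y} ->
  monotone_ac g -> continuous g.
Proof.
move=> ndg acg x; apply/cvgrPdist_le => e e0.
have [d d0 H] := acg e e0.
near=> y.
have yx : `|x - y| < d by near: y; apply: cvgr_dist_lt.
have [xy|/ltW yx'] := leP x y.
  have K := H [:: (x, y)].
  rewrite /total_length !big_seq1 /= xy in K.
  rewrite distrC ger0_norm ?subr_ge0; last exact: ndg.
  by apply: K => //; move: yx; rewrite distrC ger0_norm// subr_ge0.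
have K := H [:: (y, x)].
rewrite /total_length !big_seq1 /= yx' in K.
rewrite ger0_norm ?subr_ge0; last exact: ndg.
by apply: K => //; move: yx; rewrite ger0_norm// subr_ge0.
Unshelve. all: by end_near. Qed.

End JordanDecomposition.

(** * Densities of Stieltjes measures *)

Section StieltjesDensity.
Context {R : realType}.
Local Notation mu := (@lebesgue_measure R).
Implicit Types (s : seq (R * R)) (f : R -> R).

(** One list of intervals describes a finite disjoint union for all Stieltjes
    measures at once, so that smallness can be transported from Lebesgue
    measure to another one. *)
Lemma ocitv_measureE (g : R -> R) (nu : {measure set (measurableTypeR R) -> \bar R})
  (nuE : forall u v, u <= v -> nu `]u, v]%classic = (g v - g u)%:E)
  (B : set (set R)) : finite_set B -> trivIset B id -> (forall X, B X -> ocitv X) ->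
  exists s, [/\ all (fun p => p.1 <= p.2) s, pairwise sep_itv s &
    (forall (h : R -> R) (nu' : {measure set (measurableTypeR R) -> \bar R}),
      (forall u v, u <= v -> nu' `]u, v]%classic = (h v - h u)%:E) ->
      nu' (\bigcup_(X in B) X) = (\sum_(p <- s) (h p.2 - h p.1))%:E)].
Proof.
move=> Bfin Btriv Boc.
have /choice [p pP] : forall X, exists p : R * R, B X -> X !=set0 ->
    p.1 < p.2 /\ X = `]p.1, p.2]%classic.
  move=> X; have [[BX X0]|nBX] := pselect (B X /\ X !=set0); last first.
    by exists (0, 0) => BX X0; exfalso; apply: nBX.
  have [XE|[q q12 XE]] := (ocitvP X).1 (Boc X BX).
    by exfalso; case: X0 => x; rewrite XE.
  by exists q.
pose C := [seq X <- fset_set B | X != set0].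
have CP X : X \in C -> B X /\ X !=set0.
  rewrite mem_filter => /andP[/set0P X0]; rewrite in_fset_set// => XB.
  by split => //; exact: set_mem.
(* Empty sets are discarded: a degenerate interval could lie inside another one. *)
exists [seq p X | X <- C]; split.
- apply/allP => _ /mapP[X /CP[BX X0] ->].
  by have [/ltW] := pP X BX X0.
- rewrite pairwise_map; have : uniq C by rewrite filter_uniq ?finmap.fset_uniq.
  have : {subset C <= C} by [].
  elim: {1 3 4}C => //= X l ih sub /andP[Xl ul]; apply/andP; split; last first.
    by apply: ih => // Y Yl; apply: sub; rewrite inE Yl orbT.
  apply/allP => Y Yl.
  have [BX X0] := CP X (sub X (mem_head _ _)).
  have [BY Y0] : B Y /\ Y !=set0 by apply: CP; apply: sub; rewrite inE Yl orbT.
  have [pX XE] := pP X BX X0; have [pY YE] := pP Y BY Y0.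
  have XY : X <> Y by move=> XY; rewrite XY Yl in Xl.
  rewrite /sep_itv; apply: contra_notT XY; rewrite negb_or -!ltNge => /andP[h1 h2].
  apply: Btriv => //; exists (Num.min (p X).2 (p Y).2); split.
    rewrite {1}XE /= in_itv /= lt_min pX h2 ge_min lexx //.
  rewrite {1}YE /= in_itv /= lt_min pY h1 ge_min lexx orbT //.
- move=> h nu' nu'E; rewrite (@measure_fin_bigcup _ _ _ nu')//; last first.
    by move=> X /Boc; apply: sub_sigma_algebra.
  rewrite fsbig_finite//= big_map -sumEFin /C big_filter.
  rewrite (bigID (fun X => X == set0)) /= big1 ?add0e; last first.
    by move=> X /eqP ->; rewrite measure0.
  rewrite big_seq_cond [RHS]big_seq_cond; apply: eq_bigr => X /andP[XB /set0P X0].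
  have BX : B X by apply: set_mem; rewrite -in_fset_set.
  by have [/ltW pX XE] := pP X BX X0; rewrite {1}XE nu'E.
Qed.

Lemma lebesgue_measure_oc (u v : R) : u <= v -> mu `]u, v]%classic = (v - u)%:E.
Proof.
move=> uv; rewrite lebesgue_measure_itv /= lte_fin.
by case: ltP => // vu; rewrite (le_anti (introT andP (conj uv vu))) subrr.
Qed.

(** A null set is covered by half-open intervals of small total length. Their
    finite unions are disjoint unions of half-open intervals, to which absolute
    continuity applies; continuity from below then bounds the whole cover. *)
Lemma monotone_ac_dominated (g : R -> R) (acg : monotone_ac g)
  (nu : {measure set (measurableTypeR R) -> \bar R})
  (nuE : forall u v, u <= v -> nu `]u, v]%classic = (g v - g u)%:E) :
  nu `<< mu.
Proof.
apply/null_content_dominatesP => A mA muA.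
apply/eqP; rewrite eq_le measure_ge0 andbT; apply/lee_addgt0Pr => e e0.
rewrite add0e.
have [d d0 H] := acg e e0.
have : (mu A < d%:E)%E by rewrite muA lte_fin.
rewrite /lebesgue_measure /lebesgue_stieltjes_measure /measure_extension.
rewrite /mu_ext => /ereal_inf_lt[_ [F [mF AF] <-] Fd].
pose U N := \big[setU/set0]_(k < N) F k.
have mF' k : measurable (F k : set (measurableTypeR R)).
  by apply: sub_sigma_algebra; exact: mF.
have mU N : measurable (U N : set (measurableTypeR R)).
  exact: bigsetU_measurable.
have muF k : mu (F k) = wlength idfun (F k).
  rewrite /lebesgue_measure /lebesgue_stieltjes_measure /measure_extension.
  by rewrite measurable_mu_extE//; exact: mF.
have muU N : (mu (U N) < d%:E)%E.
  apply: le_lt_trans Fd.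
  apply: (@le_trans _ _ (\sum_(k < N) mu (F k))%E).
    exact: (@content_subadditive _ _ _ mu).
  rewrite (eq_bigr (fun k : 'I_N => wlength idfun (F k)))//.
  rewrite -(big_mkord xpredT (fun k => wlength idfun (F k))).
  exact: nneseries_lim_ge.
have nuU N : (nu (U N) <= e%:E)%E.
  have : measurable (U N : set (SetRing.type (ocitv_type R))).
    by apply: bigsetU_measurable => i _; apply: sub_gen_smallest; exact: mF.
  rewrite SetRing.ring_measurableE => -[B [UE Bm Bfin Btriv]].
  have [s [s12 seps sE]] := ocitv_measureE nuE Bfin Btriv Bm.
  rewrite UE (sE _ _ nuE) lee_fin; apply: H => //.
  by have := muU N; rewrite UE (sE idfun mu) ?lte_fin//; exact: lebesgue_measure_oc.
have ndU : nondecreasing_seq U.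
  by move=> i j ij; apply/subsetPset/subset_bigsetU.
have UF : \bigcup_n F n = \bigcup_n U n.
  rewrite -bigcup_bigsetU_bigcup; apply/seteqP; split => x [n _ xn].
    by exists n.+1.
  by exists n => //; rewrite big_ord_recr /=; left.
have mUU : measurable (\bigcup_n U n : set (measurableTypeR R)).
  exact: bigcup_measurable.
have cU : (nu \o U @ \oo --> nu (\bigcup_n U n))%E.
  exact: nondecreasing_cvg_mu.
apply: (@le_trans _ _ (nu (\bigcup_n U n))).
  rewrite UF in AF.
  by apply: le_measure => //; exact: mem_set.
rewrite -(cvg_lim _ cU)//; apply: lime_le; first by apply/cvg_ex; eexists; exact: cU.
by apply: nearW.
Qed.

(** Radon-Nikodym for the Stieltjes measure of [g], which is finite because
    the increments of [g] are bounded. *)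
Lemma monotone_ac_density (g : R -> R) (M : R) : {homo g : x y / x <= y} ->
  monotone_ac g -> (forall x y, g y - g x <= M) ->
  exists phi : R -> R, mu.-integrable setT (EFin \o phi) /\
    forall x y, x <= y -> (g y - g x)%:E = (\int[mu]_(t in `]x, y]) (phi t)%:E)%E.
Proof.
move=> ndg acg gM.
have rcg : right_continuous g.
  by apply/right_continuousW; exact: monotone_ac_continuous.
pose c : cumulative R R := HB.pack g (isCumulative.Build R _ R g ndg rcg).
pose nu0 := lebesgue_stieltjes_measure c.
have nu0E u v : u <= v -> nu0 `]u, v]%classic = (g v - g u)%:E.
  move=> uv; rewrite /nu0 /lebesgue_stieltjes_measure /measure_extension.
  by rewrite measurable_mu_extE/= ?wlength_itv_bnd//; last exact: is_ocitv.
have fin0 : fin_num_fun nu0.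
  move=> A mA; rewrite ge0_fin_numE ?measure_ge0//.
  apply: (@le_lt_trans _ _ M%:E); last by rewrite ltry.
  apply: (@le_trans _ _ (nu0 setT)); first by apply: le_measure => //; exact: mem_set.
  pose U n := `]- n%:R, n%:R : R]%classic.
  have UT : \bigcup_n U n = setT by exact: bigcup_itvT.
  have cU : (nu0 \o U @ \oo --> nu0 (\bigcup_n U n))%E.
    apply: nondecreasing_cvg_mu.
    - by move=> i; apply: sub_sigma_algebra; exact: is_ocitv.
    - by rewrite UT; exact: measurableT.
    - by move=> i j ij; apply/subsetPset/subset_itv; rewrite bnd_simp ?lerN2 ler_nat.
  rewrite UT in cU.
  rewrite -(cvg_lim _ cU)//; apply: lime_le; first by apply/cvg_ex; eexists; exact: cU.
  by apply: nearW => n /=; rewrite nu0E ?lee_fin// ge0_cp// ?ler0n.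
pose nu : {finite_measure set (measurableTypeR R) -> \bar R} :=
  HB.pack nu0 (@Measure_isFinite.Build _ _ _ nu0 fin0).
have dom : nu `<< mu by apply: (monotone_ac_dominated acg).
have [F [F0 Ffin Fint FE]] := radon_nikodym_sigma_finite dom.
exists (fine \o F); split.
  by apply: eq_integrable Fint => //= x _; rewrite /= fineK.
move=> x y xy; rewrite -nu0E// [LHS]FE//.
by apply: eq_integral => t _; rewrite /= fineK.
Qed.

End StieltjesDensity.

(** * The fundamental theorem of calculus for absolutely continuous functions *)

Section FundamentalTheorem.
Context {R : realType}.
Local Notation mu := (@lebesgue_measure R).

Lemma ae_imp (P Q : R -> Prop) : (forall x, P x -> Q x) ->
  {ae mu, forall x, P x} -> {ae mu, forall x, Q x}.
Proof.
by move=> PQ; apply: negligibleS => x /=; apply: contra_not; exact: PQ.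
Qed.

Lemma ae_imp2 (P Q S : R -> Prop) : (forall x, P x -> Q x -> S x) ->
  {ae mu, forall x, P x} -> {ae mu, forall x, Q x} -> {ae mu, forall x, S x}.
Proof.
move=> PQS aeP aeQ; have : mu.-negligible (~` [set x | P x] `|` ~` [set x | Q x]).
  exact: negligibleU.
apply: negligibleS => x /=; rewrite -not_andE; apply: contra_not => -[].
exact: PQS.
Qed.

(** The density is the difference of the densities of the two monotone pieces,
    and Lebesgue differentiation of its integral yields differentiability of
    [f] almost everywhere. *)
Lemma absolutely_continuous_density (a b : R) (f : R -> R) : a < b ->
  Defs.absolutely_continuous a b f ->
  exists phi : R -> R, [/\ mu.-integrable setT (EFin \o phi),
    forall x y, a <= x -> x <= y -> y <= b ->
      (f y - f x)%:E = (\int[mu]_(t in `]x, y]) (phi t)%:E)%E &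
    {ae mu, forall x, a < x < b -> is_derive x 1 f (phi x)}].
Proof.
move=> ab acf; have ab' := ltW ab.
pose g1 := tv a f \o clamp a b; pose g2 := (tv a f \- f) \o clamp a b.
have nd1 : {homo g1 : x y / x <= y} by exact: tv_clamp_nd.
have nd2 : {homo g2 : x y / x <= y} by exact: tvB_clamp_nd.
have bnd (h : R -> R) : {homo (h \o clamp a b) : x y / x <= y} ->
    forall x y, (h \o clamp a b) y - (h \o clamp a b) x <= h b - h a.
  move=> ndh x y; have E z : clamp a b (clamp a b z) = clamp a b z.
    by apply: clamp_id; exact: clamp_in.
  have /andP[ax xb] := clamp_in x ab'; have /andP[ay yb] := clamp_in y ab'.
  have := ndh _ _ yb; have := ndh _ _ ax.
  rewrite /= !E (@clamp_id _ a b a) ?lexx ?ab' // (@clamp_id _ a b b) ?lexx ?ab' //.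
  lra.
have [phi1 [int1 E1]] := monotone_ac_density nd1 (monotone_ac_tv ab' acf) (bnd _ nd1).
have [phi2 [int2 E2]] := monotone_ac_density nd2 (monotone_ac_tvB ab' acf) (bnd _ nd2).
pose phi := phi1 \- phi2.
have intphi : mu.-integrable setT (EFin \o phi).
  have -> : EFin \o phi = ((EFin \o phi1) \- (EFin \o phi2))%E by [].
  exact: integrableB.
have phiE x y : a <= x -> x <= y -> y <= b ->
      (f y - f x)%:E = (\int[mu]_(t in `]x, y]) (phi t)%:E)%E.
  move=> ax xy yb.
  have := E1 _ _ xy; have := E2 _ _ xy.
  rewrite /g1 /g2 /= (@clamp_id _ a b x) ?ax ?(le_trans xy)//.
  rewrite (@clamp_id _ a b y) ?yb ?(le_trans ax)// => e2 e1.
  rewrite [RHS](_ : _ = (\int[mu]_(t in `]x, y]) (phi1 t)%:E -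
                         \int[mu]_(t in `]x, y]) (phi2 t)%:E)%E); last first.
    rewrite -integralB//; exact: integrableS int1 || exact: integrableS int2.
  by rewrite -e1 -e2 -EFinB; congr (_%:E); ring.
exists phi; split => //.
have intS y : mu.-integrable [set` Interval (BRight a) (BRight y)] (EFin \o phi).
  exact: integrableS intphi.
have loc : locally_integrable [set: R] phi.
  by apply: open_integrable_locally => //; exact: openT.
have := FTC1 intS loc.
apply: ae_imp => x H /andP[ax xb].
have [dF FE] := H ax.
pose F y := \int[mu]_(t in [set` Interval (BRight a) (BRight y)]) phi t.
have idF : is_derive x 1 F (phi x).
  by split; [exact: dF|rewrite -FE derive1E].
have idF' : is_derive x 1 (cst (f a) + F) (phi x).
  by apply: is_derive_eq; rewrite add0r.
apply: near_eq_is_derive idF'.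
have xab : x \in `]a, b[ by rewrite in_itv /= ax xb.
near=> y.
have : y \in `]a, b[ by near: y; exact: near_in_itvoo.
rewrite in_itv /= => /andP[ay yb].
by rewrite /F /Rintegral fctE /= -phiE ?lexx ?(ltW ay) ?(ltW yb)//= /cst addrC subrK.
Unshelve. all: by end_near. Qed.

Lemma locally_absolutely_continuous_derivable (f : R -> R) :
  locally_absolutely_continuous f -> {ae mu, forall x, derivable f x 1}.
Proof.
move=> lacf.
have H n : {ae mu, forall x, - n%:R < x < n%:R -> derivable f x 1}.
  have [n0|n0] := ltP (- (n%:R : R)) n%:R; last first.
    by apply: aeW => x /andP[h1 h2]; have := lt_trans h1 h2; rewrite ltNge n0.
  have [phi [_ _]] := absolutely_continuous_density n0 (lacf _ _ (ltW n0)).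
  by apply: ae_imp => x + hx => /(_ hx) [].
move/ae_foralln : H; apply: ae_imp.
move=> x /(_ (Num.bound x)); apply; rewrite unstable.ltr_bound andbT.
by rewrite ltrNl unstable.ltrNbound.
Qed.

(** The form used below: the derivative is only known almost everywhere, through
    a measurable representative. *)
Lemma locally_absolutely_continuous_FTC (f g : R -> R) :
  locally_absolutely_continuous f ->
  measurable_fun setT g ->
  {ae mu, forall x, derive1 f x = g x} ->
  forall x y, x <= y -> (f y - f x)%:E = (\int[mu]_(t in `]x, y]) (g t)%:E)%E.
Proof.
move=> lacf mg fg x y; rewrite le_eqVlt => /predU1P[<-|xy].
  by rewrite subrr set_itvoc0 integral_set0.
have xy1 : x - 1 < y + 1 by lra.
have [phi [intphi E ae_phi]] :=
  absolutely_continuous_density xy1 (lacf _ _ (ltW xy1)).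
have xx1 : x - 1 <= x by lra.
have yy1 : y <= y + 1 by lra.
rewrite (E _ _ xx1 (ltW xy) yy1).
have mphi : measurable_fun setT phi.
  by case/integrableP: intphi => /measurable_EFinP.
apply: ae_eq_integral => //.
- by apply/measurable_EFinP; exact: measurable_funTS.
- by apply/measurable_EFinP; exact: measurable_funTS.
apply: ae_imp2 ae_phi fg => t H1 <- /=; rewrite in_itv /= => /andP[xt ty].
have H2 : x - 1 < t < y + 1 by apply/andP; split; lra.
by have [_ <-] := H1 H2; rewrite derive1E.
Qed.

End FundamentalTheorem.

(** * Exponential moments and differentiation under the integral *)

Section ExponentialMoments.
Context {R : realType}.
Local Notation mu := (@lebesgue_measure R).
Implicit Types (f g : R -> R) (s t x : R).

Definition laplace_integrable f s :=
  mu.-integrable setT (EFin \o (fun x => f x * expR (- (s * x)))).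

(** Integrability on a neighbourhood of [s], rather than at [s] alone, is
    inherited by multiplication by polynomials. *)
Definition locally_laplace_integrable f s :=
  exists2 e : R, 0 < e & forall t, `|t - s| <= e -> laplace_integrable f t.

Lemma measurable_expR_lin s : measurable_fun setT (fun x : R => expR (- (s * x))).
Proof.
by apply: measurableT_comp => //; apply: measurableT_comp => //.
Qed.

Lemma expR_lin_derive s x :
  is_derive x 1 (fun x => expR (- (s * x))) (- s * expR (- (s * x))).
Proof.
have dl : is_derive x 1 (fun t : R => - (s * t)) (- s).
  have -> : (fun t : R => - (s * t)) = (- s) \*: id.
    by apply/funext => r; rewrite /= /GRing.scale /=; ring.
  by apply: is_derive_eq; rewrite /GRing.scale /=; ring.
have de : is_derive x 1 (expR \o (fun t : R => - (s * t))) (expR (- (s * x)) * (- s)).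
  exact: is_derive1_comp.
by apply: is_derive_eq de _; ring.
Qed.

Lemma laplace_integrable_measurable f s : laplace_integrable f s ->
  measurable_fun setT f.
Proof.
case/integrableP => /measurable_EFinP mf _.
have -> : f = (fun x => f x * expR (- (s * x)) * expR (- (- s * x))).
  by apply/funext => x; rewrite -mulrA -expRD mulNr opprK addNr expR0 mulr1.
by apply: measurable_funM => //; exact: measurable_expR_lin.
Qed.

Lemma laplace_integrable_le f g s (C : R) : measurable_fun setT f ->
  laplace_integrable g s -> (forall x, `|f x| <= C * `|g x|) ->
  laplace_integrable f s.
Proof.
move=> mf ig fg.
have igC : mu.-integrable setT (fun x => (C%:E * (g x * expR (- (s * x)))%R%:E)%E).
  exact: integrableZl.
apply: le_integrable igC => //.
  by apply/measurable_EFinP; apply: measurable_funM => //; exact: measurable_expR_lin.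
move=> x _ /=; rewrite lee_fin !normrM mulrA.
rewrite ler_wpM2r//; apply: (le_trans (fg x)).
by rewrite ler_wpM2r// ler_norm.
Qed.

Lemma laplace_integrableD f g s : laplace_integrable f s ->
  laplace_integrable g s -> laplace_integrable (fun x => f x + g x) s.
Proof.
move=> fi gi; rewrite /laplace_integrable.
have -> : EFin \o (fun x => (f x + g x) * expR (- (s * x))) =
   ((EFin \o (fun x => f x * expR (- (s * x)))%R) \+
    (EFin \o (fun x => g x * expR (- (s * x)))%R))%E.
  by apply/funext => x /=; rewrite mulrDl.
exact: integrableD.
Qed.

Lemma laplace_integrableZ f s (c : R) : laplace_integrable f s ->
  laplace_integrable (fun x => c * f x) s.
Proof.
move=> fi; rewrite /laplace_integrable.
have -> : EFin \o (fun x => c * f x * expR (- (s * x))) =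
   (fun x => (c%:E * (f x * expR (- (s * x)))%R%:E)%E).
  by apply/funext => x /=; rewrite -mulrA.
exact: integrableZl.
Qed.

Lemma laplace_integrable0 s : laplace_integrable (fun=> 0) s.
Proof.
rewrite /laplace_integrable (_ : _ \o _ = cst 0%E); first exact: integrable0.
by apply/funext => x /=; rewrite mul0r.
Qed.

Lemma laplace_integrable_sum (I : finType) (c : I -> R) (F : I -> R -> R) s :
  (forall i, laplace_integrable (F i) s) ->
  laplace_integrable (fun x => \sum_i c i * F i x) s.
Proof.
move=> Fi.
have -> : (fun x => \sum_i c i * F i x) = \sum_i (fun x => c i * F i x).
  by apply/funext => x; rewrite fct_sumE.
elim/big_ind : _ => [|u v ui vi|i _]; first exact: laplace_integrable0.
  exact: laplace_integrableD.
exact: laplace_integrableZ.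
Qed.

Lemma LaplaceD f g s : laplace_integrable f s -> laplace_integrable g s ->
  Laplace (fun x => f x + g x) s = Laplace f s + Laplace g s.
Proof.
move=> fi gi; rewrite /Laplace -RintegralD//.
by apply: eq_Rintegral => x _; rewrite mulrDl.
Qed.

Lemma LaplaceZ f s (c : R) : laplace_integrable f s ->
  Laplace (fun x => c * f x) s = c * Laplace f s.
Proof.
move=> fi; rewrite /Laplace -RintegralZl//.
by apply: eq_Rintegral => x _; rewrite mulrA.
Qed.

Lemma Laplace0 s : Laplace (fun=> 0 : R) s = 0.
Proof.
rewrite /Laplace; under eq_Rintegral do rewrite mul0r.
by rewrite Rintegral_cst// mul0r.
Qed.

Lemma Laplace_sum (I : finType) (c : I -> R) (F : I -> R -> R) s :
  (forall i, laplace_integrable (F i) s) ->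
  Laplace (fun x => \sum_i c i * F i x) s = \sum_i c i * Laplace (F i) s.
Proof.
move=> Fi.
suff [_] : laplace_integrable (fun x => \sum_i c i * F i x) s /\
  Laplace (fun x => \sum_i c i * F i x) s = \sum_i c i * Laplace (F i) s by [].
have -> : (fun x => \sum_i c i * F i x) = \sum_i (fun x => c i * F i x).
  by apply/funext => x; rewrite fct_sumE.
elim/big_ind2 : _ => [|u a v b [ui <-] [vi <-]|i _].
- by split; [exact: laplace_integrable0|exact: Laplace0].
- by split; [exact: laplace_integrableD|exact: LaplaceD].
- by split; [exact: laplace_integrableZ|exact: LaplaceZ].
Qed.

Lemma expR_between s1 s2 t x : s1 <= t <= s2 ->
  expR (- (t * x)) <= expR (- (s1 * x)) + expR (- (s2 * x)).
Proof.
move=> /andP[h1 h2]; have [x0|x0] := leP 0 x.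
  apply: (@le_trans _ _ (expR (- (s1 * x)))); last by rewrite lerDl expR_ge0.
  by rewrite ler_expR lerN2 ler_wpM2r.
apply: (@le_trans _ _ (expR (- (s2 * x)))); last by rewrite lerDr expR_ge0.
by rewrite ler_expR lerN2 ler_wnM2r// ltW.
Qed.

(** The constant comes from [y <= expR y] at [y = eta |x| / m], raised to the
    power [k]; [m = k + 1] avoids a division by zero when [k = 0]. *)
Lemma pow_le_expR (k : nat) (eta : R) : 0 < eta ->
  exists2 C : R, 0 <= C & forall x, `|x| ^+ k <= C * expR (eta * `|x|).
Proof.
move=> eta0; pose m := k.+1%:R : R.
have m0 : 0 < m by rewrite ltr0n.
exists ((m / eta) ^+ k); first by rewrite exprn_ge0// divr_ge0// ltW.
move=> x; have h : `|x| <= (m / eta) * expR (eta * `|x| / m).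
  rewrite -ler_pdivrMl ?divr_gt0// invf_div mulrAC.
  by apply: le_trans (expR_ge1Dx _); rewrite lerDr.
apply: (@le_trans _ _ (((m / eta) * expR (eta * `|x| / m)) ^+ k)).
  by rewrite lerXn2r ?nnegrE// mulr_ge0 ?expR_ge0// divr_ge0// ltW.
rewrite exprMn ler_wpM2l ?exprn_ge0 ?divr_ge0 ?(ltW m0) ?(ltW eta0)//.
rewrite -expRM_natl ler_expR.
have -> : k%:R * (eta * `|x| / m) = k%:R / m * (eta * `|x|) by ring.
rewrite ler_piMl ?mulr_ge0 ?(ltW eta0)//.
by rewrite ler_pdivrMr// mul1r /m ler_nat.
Qed.

(** Between two exponents there is room to absorb a power of [x]. The bound is
    uniform in [s], hence usable for dominated convergence. *)
Lemma pow_expR_le (k : nat) s1 u v s2 : s1 < u -> v < s2 ->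
  exists2 C : R, 0 <= C & forall s x, u <= s <= v ->
    `|x| ^+ k * expR (- (s * x)) <= C * (expR (- (s1 * x)) + expR (- (s2 * x))).
Proof.
move=> s1u vs2; pose eta := Num.min (u - s1) (s2 - v).
have eta0 : 0 < eta by rewrite lt_min !subr_gt0 s1u.
have [C C0 HC] := pow_le_expR k eta0; exists C => // s x /andP[us sv].
apply: (@le_trans _ _ (C * expR (eta * `|x|) * expR (- (s * x)))).
  by rewrite ler_wpM2r ?expR_ge0.
rewrite -mulrA ler_wpM2l// -expRD.
have e1 : eta <= u - s1 by rewrite ge_min lexx.
have e2 : eta <= s2 - v by rewrite ge_min lexx orbT.
have [x0|x0] := ger0P x.
  have -> : eta * x - s * x = - ((s - eta) * x) by ring.
  by apply: expR_between; apply/andP; split; lra.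
have -> : eta * - x - s * x = - ((s + eta) * x) by ring.
by apply: expR_between; apply/andP; split; lra.
Qed.

Lemma laplace_moment_majorant f s1 s2 (C : R) :
  laplace_integrable f s1 -> laplace_integrable f s2 ->
  mu.-integrable setT (EFin \o (fun x =>
    C * `|f x| * (expR (- (s1 * x)) + expR (- (s2 * x))))).
Proof.
move=> i1 i2; have mf := laplace_integrable_measurable i1.
have ia s : laplace_integrable f s -> laplace_integrable (fun x => C * `|f x|) s.
  move=> i; apply: laplace_integrableZ; apply: (@laplace_integrable_le _ f s 1) => //.
    exact: measurableT_comp.
  by move=> x; rewrite mul1r normr_id.
have -> : EFin \o (fun x => C * `|f x| * (expR (- (s1 * x)) + expR (- (s2 * x)))) =
   ((EFin \o (fun x => C * `|f x| * expR (- (s1 * x)))%R) \+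
    (EFin \o (fun x => C * `|f x| * expR (- (s2 * x)))%R))%E.
  by apply/funext => x /=; rewrite mulrDr.
by apply: integrableD => //; exact: ia.
Qed.

Lemma laplace_integrable_pow f s1 s2 (k : nat) s : s1 < s < s2 ->
  laplace_integrable f s1 -> laplace_integrable f s2 ->
  laplace_integrable (fun x => x ^+ k * f x) s.
Proof.
move=> /andP[s1s ss2] i1 i2.
have mf := laplace_integrable_measurable i1.
have [C C0 HC] := pow_expR_le k s1s ss2.
have iG := laplace_moment_majorant C i1 i2.
apply: le_integrable iG => //.
  apply/measurable_EFinP; apply: measurable_funM; last exact: measurable_expR_lin.
  by apply: measurable_funM => //; exact: measurable_funX.
move=> x _ /=; rewrite lee_fin [leRHS]ger0_norm; last first.
  by rewrite !mulr_ge0// addr_ge0 ?expR_ge0.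
rewrite !normrM normrX (ger0_norm (expR_ge0 _)).
rewrite mulrAC [leLHS]mulrC -[leRHS]mulrA [leRHS]mulrCA ler_wpM2l//.
by apply: HC; rewrite lexx.
Qed.

Lemma laplace_integrable_between f s1 s2 s : s1 < s < s2 ->
  laplace_integrable f s1 -> laplace_integrable f s2 -> laplace_integrable f s.
Proof.
move=> s12 i1 i2; have := laplace_integrable_pow 0 s12 i1 i2.
by under eq_fun do rewrite expr0 mul1r.
Qed.

Lemma locally_laplace_between f s1 s2 s : s1 < s < s2 ->
  laplace_integrable f s1 -> laplace_integrable f s2 ->
  locally_laplace_integrable f s.
Proof.
move=> /andP[s1s ss2] i1 i2; pose e := Num.min ((s - s1) / 2) ((s2 - s) / 2).
have e1 : e <= (s - s1) / 2 by rewrite ge_min lexx.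
have e2 : e <= (s2 - s) / 2 by rewrite ge_min lexx orbT.
exists e; first by rewrite lt_min !divr_gt0// subr_gt0.
move=> t; rewrite ler_norml => /andP[h1 h2].
by apply: laplace_integrable_between i1 i2; apply/andP; split; lra.
Qed.

Lemma locally_laplace_at f s : locally_laplace_integrable f s ->
  laplace_integrable f s.
Proof. by move=> [e e0]; apply; rewrite subrr normr0 ltW. Qed.

Lemma locally_laplace_pow f s (k : nat) : locally_laplace_integrable f s ->
  locally_laplace_integrable (fun x => x ^+ k * f x) s.
Proof.
move=> [e e0 H]; exists (e / 2); first by rewrite divr_gt0.
move=> t; rewrite ler_norml => /andP[h1 h2].
apply: (@laplace_integrable_pow _ (s - e) (s + e)); first by apply/andP; split; lra.
  by apply: H; rewrite addrAC subrr add0r normrN ger0_norm ?(ltW e0).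
by apply: H; rewrite addrAC subrr add0r ger0_norm ?(ltW e0).
Qed.

Lemma locally_laplace_sum (I : finType) (c : I -> R) (F : I -> R -> R) s :
  (forall i, locally_laplace_integrable (F i) s) ->
  locally_laplace_integrable (fun x => \sum_i c i * F i x) s.
Proof.
move=> Fi.
suff [e e0 H] : exists2 e : R, 0 < e & forall i t, `|t - s| <= e ->
    laplace_integrable (F i) t.
  by exists e => // t te; apply: laplace_integrable_sum => i; exact: H.
have /choice[E HE] : forall i, exists e : R, 0 < e /\
    forall t, `|t - s| <= e -> laplace_integrable (F i) t.
  by move=> i; have [e e0 H] := Fi i; exists e.
exists (\big[Num.min/1]_i E i).
  by elim/big_ind : _ => // [x y x0 y0|i _]; [rewrite lt_min x0|case: (HE i)].
move=> i t te; have [_] := HE i; apply; apply: (le_trans te).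
exact: bigmin_le_cond.
Qed.

Lemma locally_laplace_near f s : locally_laplace_integrable f s ->
  \forall t \near s, locally_laplace_integrable f t.
Proof.
move=> [e e0 H]; near=> t; exists (e / 2); first by rewrite divr_gt0.
move=> u ut; apply: H.
have st : `|s - t| < e / 2.
  by near: t; apply: cvgr_dist_lt => //; rewrite divr_gt0.
have -> : u - s = (u - t) - (s - t) by ring.
by apply: (le_trans (ler_normB _ _)); lra.
Unshelve. all: by end_near. Qed.

Lemma is_derive_Laplace f s : locally_laplace_integrable f s ->
  is_derive s 1 (Laplace f) (- Laplace (fun x => x * f x) s).
Proof.
move=> [e e0 H].
have i1 : laplace_integrable f (s - e).
  by apply: H; rewrite addrAC subrr add0r normrN ger0_norm ?(ltW e0).
have i2 : laplace_integrable f (s + e).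
  by apply: H; rewrite addrAC subrr add0r ger0_norm ?(ltW e0).
pose u := s - e / 2; pose v := s + e / 2.
have su : s - e < u by rewrite /u; lra.
have vs : v < s + e by rewrite /v; lra.
have [C C0 HC] := pow_expR_le 1 su vs.
pose F t x := f x * expR (- (t * x)).
have dF t x : is_derive t 1 (F ^~ x) (- (x * f x * expR (- (t * x)))).
  have de := expR_lin_derive x t.
  have -> : F ^~ x = f x \*: (fun t : R => expR (- (x * t))).
    by apply/funext => y; rewrite /F /= (mulrC y).
  by apply: is_derive_eq; rewrite (mulrC t) /GRing.scale /=; ring.
have Is : `]u, v[%classic s by rewrite /= in_itv /= /u /v; apply/andP; split; lra.
have iF t : `]u, v[%classic t -> mu.-integrable setT (EFin \o F t).
  rewrite /= in_itv /= /u /v => /andP[ut tv]; apply: H.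
  by rewrite ler_norml; apply/andP; split; lra.
have d1 t x : partial1of2 F t x = - (x * f x * expR (- (t * x))).
  by rewrite partial1of2E; case: (dF t x).
have G0 x : 0 <= C * `|f x| * (expR (- ((s - e) * x)) + expR (- ((s + e) * x))).
  by rewrite !mulr_ge0// addr_ge0 ?expR_ge0.
have iG := laplace_moment_majorant C i1 i2.
have Gub t x : `]u, v[%classic t -> setT x -> `|partial1of2 F t x| <=
    C * `|f x| * (expR (- ((s - e) * x)) + expR (- ((s + e) * x))).
  rewrite /= in_itv /= => /andP[/ltW ut /ltW tv] _.
  rewrite d1 normrN !normrM (ger0_norm (expR_ge0 _)).
  rewrite mulrAC [leLHS]mulrC -[leRHS]mulrA [leRHS]mulrCA ler_wpM2l//.
  by have := HC t x; rewrite expr1; apply; rewrite ut.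
have derF t x : `]u, v[%classic t -> setT x -> derivable (F ^~ x) t 1.
  by move=> _ _; case: (dF t x).
have dv := @derivable_under_integral _ _ _ mu F setT measurableT s u v Is iF derF
  _ G0 iG Gub.
have dE := @differentiation_under_integral _ _ _ mu F setT measurableT s u v Is iF derF
  _ G0 iG Gub.
split => //; rewrite -derive1E; rewrite [LHS]dE /Laplace.
rewrite -[RHS]mulN1r -RintegralZl//; last first.
  have := locally_laplace_at (locally_laplace_pow 1 (ex_intro2 _ _ e e0 H)).
  by rewrite /laplace_integrable; under [X in EFin \o X]eq_fun do rewrite expr1.
by apply: eq_Rintegral => x _; rewrite d1 mulN1r.
Qed.

End ExponentialMoments.

(** * The transform of a derivative *)

Section LaplaceDerivative.
Context {R : realType}.
Local Notation mu := (@lebesgue_measure R).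
Implicit Types (f g h : R -> R) (s x y a b : R).

Lemma absolutely_continuous_bounded a b f : a <= b ->
  Defs.absolutely_continuous a b f ->
  exists2 M : R, 0 <= M & forall x, a <= x <= b -> `|f x| <= M.
Proof.
move=> ab acf; exists (`|f a| + tv a f b).
  by rewrite addr_ge0// fine_ge0// total_variation_ge0.
move=> x /andP[ax xb].
have h1 := tv_ge acf (lexx a) ax xb.
have h2 := tv_ge acf ax xb (lexx b).
have t0 : tv a f a = 0 by rewrite /tv total_variationxx.
have := normr_ge0 (f b - f x); have := ler_normD (f x - f a) (f a).
by rewrite subrK; lra.
Qed.

(** Write the increment of a product as [g v * (f v - f u) + f u * (g v - g u)]
    and bound the coefficients on the segment. *)
Lemma absolutely_continuousM a b f g : a <= b ->
  Defs.absolutely_continuous a b f -> Defs.absolutely_continuous a b g ->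
  Defs.absolutely_continuous a b (fun x => f x * g x).
Proof.
move=> ab acf acg e e0.
have [M M0 HM] := absolutely_continuous_bounded ab acf.
have [N N0 HN] := absolutely_continuous_bounded ab acg.
have eN : 0 < e / (2 * (N + 1)) by rewrite divr_gt0// mulr_gt0//; lra.
have eM : 0 < e / (2 * (M + 1)) by rewrite divr_gt0// mulr_gt0//; lra.
have [d1 d10 H1] := acf _ eN; have [d2 d20 H2] := acg _ eM.
exists (Num.min d1 d2) => [|n u v uv dis].
  by rewrite lt_min d10.
rewrite lt_min => /andP[l1 l2].
have {}H1 := H1 _ _ _ uv dis l1; have {}H2 := H2 _ _ _ uv dis l2.
apply: (@le_lt_trans _ _ (\sum_i (N * `|f (v i) - f (u i)| + M * `|g (v i) - g (u i)|))).
  apply: ler_sum => i _; have [au [uv' vb]] := uv i.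
  have -> : f (v i) * g (v i) - f (u i) * g (u i) =
    g (v i) * (f (v i) - f (u i)) + f (u i) * (g (v i) - g (u i)) by ring.
  apply: (le_trans (ler_normD _ _)); rewrite !normrM lerD// ler_wpM2r//.
    by apply: HN; rewrite vb (le_trans au).
  by apply: HM; rewrite au (le_trans uv').
rewrite big_split /= -!mulr_sumr.
have le2 (K E : R) : 0 <= K -> E < e / (2 * (K + 1)) -> 0 <= E -> K * E < e / 2.
  move=> K0 + E0; rewrite ltr_pdivlMr; last by rewrite mulr_gt0//; lra.
  nra.
have s1 : 0 <= \sum_i `|f (v i) - f (u i)| by exact: sumr_ge0.
have s2 : 0 <= \sum_i `|g (v i) - g (u i)| by exact: sumr_ge0.
have := le2 _ _ N0 H1 s1; have := le2 _ _ M0 H2 s2; lra.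
Qed.

Lemma lipschitz_absolutely_continuous a b f (K : R) : 0 <= K ->
  (forall x y, a <= x -> x <= y -> y <= b -> `|f y - f x| <= K * (y - x)) ->
  Defs.absolutely_continuous a b f.
Proof.
move=> K0 HK e e0; exists (e / (K + 1)) => [|n u v uv dis len].
  by rewrite divr_gt0//; lra.
apply: (@le_lt_trans _ _ (\sum_i K * (v i - u i))).
  by apply: ler_sum => i _; have [? [? ?]] := uv i; exact: HK.
rewrite -mulr_sumr.
have s0 : 0 <= \sum_i (v i - u i).
  by apply: sumr_ge0 => i _; have [_ [? _]] := uv i; rewrite subr_ge0.
by move: len; rewrite ltr_pdivlMr; [nra|lra].
Qed.

Lemma C1_locally_absolutely_continuous f : (forall x, derivable f x 1) ->
  continuous (derive1 f) -> locally_absolutely_continuous f.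
Proof.
move=> df cf' a b ab.
have cn : {within `[a, b], continuous (fun t => `|derive1 f t|)}.
  apply: continuous_subspaceT => x.
  by apply: continuous_comp; [exact: cf'|exact: norm_continuous].
have [c _ Hc] := EVT_max ab cn.
apply: (@lipschitz_absolutely_continuous _ _ _ `|derive1 f c|) => // x y ax xy yb.
have cf : {within `[x, y], continuous f}.
  apply: continuous_subspaceT => z.
  by apply: differentiable_continuous; exact/derivable1_diffP.
have idf z : z \in `]x, y[ -> is_derive z 1 f (derive1 f z).
  by move=> _; split; rewrite ?derive1E.
have [c' cxy ->] := MVT_segment xy idf cf.
rewrite normrM (ger0_norm (_ : 0 <= y - x)) ?subr_ge0// ler_wpM2r ?subr_ge0//.
apply: Hc; move: cxy; rewrite !in_itv /= => /andP[h1 h2].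
by rewrite (le_trans ax h1) (le_trans h2 yb).
Qed.

Lemma expR_lin_lac s : locally_absolutely_continuous (fun x => expR (- (s * x))).
Proof.
have E : derive1 (fun x => expR (- (s * x))) = (fun x => - s * expR (- (s * x))).
  by apply/funext => x; rewrite derive1E; case: (expR_lin_derive s x).
apply: C1_locally_absolutely_continuous => [x|x]; first by case: (expR_lin_derive s x).
have c : {for x, continuous (fun t => expR (- (s * t)))}.
  apply: differentiable_continuous; apply/derivable1_diffP.
  by case: (expR_lin_derive s x).
by rewrite E; apply: cvgM; [exact: cvg_cst|exact: c].
Qed.

(** An integrable function need not tend to zero at infinity, but it cannot stay
    away from zero on a set of infinite measure. *)
Lemma integrable_small_at_infty h (a e : R) : mu.-integrable setT (EFin \o h) -> 0 < e ->
  (exists2 x, a <= x & `|h x| <= e) /\ (exists2 x, x <= a & `|h x| <= e).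
Proof.
move=> /integrableP[mh hoo] e0.
suff H (D : set R) : measurable D -> mu D = +oo%E -> exists2 x, D x & `|h x| <= e.
  split.
    have [|//|] := H `[a, +oo[%classic; rewrite ?lebesgue_measure_itv /= ?ltry//.
    by move=> x /=; rewrite in_itv /= andbT => ax hx; exists x.
  have [|//|] := H `]-oo, a]%classic; rewrite ?lebesgue_measure_itv /= ?ltNyr//.
  by move=> x /=; rewrite in_itv /= => ax hx; exists x.
move=> mD Doo; apply: contrapT => nH.
have : (\int[mu]_(x in D) `|(h x)%:E| < +oo)%E.
  apply: le_lt_trans hoo; apply: ge0_subset_integral => //.
  exact: measurableT_comp.
rewrite ltNge => /negP; apply; rewrite -(@gt0_mulye _ e%:E)// -Doo muleC.
rewrite -integral_cst//; apply: ge0_le_integral => //.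
- by move=> x _; rewrite lee_fin ltW.
- by apply: measurableT_comp => //; exact: measurable_funTS.
- by move=> x Dx; rewrite lee_fin leNgt; apply/negP => hx; apply: nH; exists x => //; exact: ltW.
Qed.

(** Evaluate the increments between points tending to plus and minus infinity
    along which [h] tends to zero. *)
Lemma integral_increment_eq0 h k : mu.-integrable setT (EFin \o h) ->
  mu.-integrable setT (EFin \o k) ->
  (forall x y, x <= y -> (h y - h x)%:E = (\int[mu]_(t in `]x, y]) (k t)%:E)%E) ->
  \int[mu]_x k x = 0.
Proof.
move=> ih ik hk.
have /choice[B HB] (n : nat) : exists b : R, n%:R <= b /\ `|h b| <= n.+1%:R^-1.
  by have [[b ? ?] _] := @integrable_small_at_infty h n%:R n.+1%:R^-1 ih ltac:(by []); exists b.
have /choice[A HA] (n : nat) : exists a : R, a <= - n%:R /\ `|h a| <= n.+1%:R^-1.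
  by have [_ [b ? ?]] := @integrable_small_at_infty h (- n%:R) n.+1%:R^-1 ih ltac:(by []); exists b.
have AB n : A n <= B n.
  have [h1 _] := HA n; have [h2 _] := HB n.
  by have := ler0n R n; lra.
pose kn n := (EFin \o k) \_ `]A n, B n]%classic.
have mk : measurable_fun setT (EFin \o k) by case/integrableP : ik.
have mkn n : measurable_fun setT (kn n).
  by apply/(measurable_restrictT _ _).1 => //; exact: measurable_funTS.
have ckn : {ae mu, forall x, setT x -> kn n x @[n --> \oo] --> (EFin \o k) x}.
  apply: aeW => x _; apply: cvg_near_cst; near=> n.
  rewrite /kn patchE mem_set//= in_itv /=.
  have [h1 _] := HA n; have [h2 _] := HB n.
  have : `|x| < n%:R by near: n; exact: nbhs_infty_gtr.
  by rewrite ltr_norml => /andP[h3 h4]; apply/andP; split; lra.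
have dkn : {ae mu, forall x n, setT x -> (`|kn n x| <= `|(k x)%:E|)%E}.
  by apply: aeW => x n _; rewrite /kn patchE; case: ifP => // _; rewrite abse0.
have [_ _ lim1] := @dominated_convergence _ _ _ mu _ measurableT kn _ _ mkn mk ckn
  (integrable_abse ik) dkn.
have lim2 : (\int[mu]_x kn n x)%E @[n --> \oo] --> 0%:E.
  have -> : (fun n => (\int[mu]_x kn n x)%E) = EFin \o (fun n => h (B n) - h (A n)).
    by apply/funext => n /=; rewrite -integral_mkcond -hk.
  apply: cvg_EFin; first by near=> n.
  apply: norm_cvg0; apply: (@squeeze_cvgr _ _ _ _ (cst 0) (fun n => 2 * n.+1%:R^-1)).
  - near=> n; rewrite normr_ge0 /=; have [_ h1] := HA n; have [_ h2] := HB n.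
    by apply: (le_trans (ler_normB _ _)); rewrite mulr_natl mulr2n lerD.
  - exact: cvg_cst.
  - by rewrite -[X in _ --> X](mulr0 2); apply: cvgM; [exact: cvg_cst|exact: cvg_harmonic].
rewrite /Rintegral; have -> := cvg_unique _ lim1 lim2.
by [].
Unshelve. all: by end_near. Qed.

(** Integration by parts, with a derivative existing only almost everywhere: the
    function [x |-> f x * expR (- (s * x))] is locally absolutely continuous, its
    derivative is integrable, and that derivative integrates to zero. *)
Lemma Laplace_derivative f g s : locally_absolutely_continuous f ->
  {ae mu, forall x, derive1 f x = g x} ->
  laplace_integrable f s -> laplace_integrable g s ->
  Laplace g s = s * Laplace f s.
Proof.
move=> lacf fg fi gi.
pose E x : R := expR (- (s * x)).
pose h x := f x * E x; pose k x := g x * E x - s * h x.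
have mf := laplace_integrable_measurable fi.
have mg := laplace_integrable_measurable gi.
have lach : locally_absolutely_continuous h.
  move=> a b ab; apply: absolutely_continuousM => //; first exact: lacf.
  exact: expR_lin_lac.
have mk : measurable_fun setT k.
  apply: measurable_funB.
    by apply: measurable_funM => //; exact: measurable_expR_lin.
  apply: measurable_funM => //.
  by apply: measurable_funM => //; exact: measurable_expR_lin.
have hk : {ae mu, forall x, derive1 h x = k x}.
  apply: ae_imp2 fg (locally_absolutely_continuous_derivable lacf) => x fgx dfx.
  have d1 : is_derive x 1 f (derive1 f x) by split; [exact: dfx|rewrite derive1E].
  have d2 := expR_lin_derive s x.
  have [_ H] := is_deriveM d1 d2.
  rewrite derive1E [LHS]H /k /h /E -fgx /GRing.scale /=; ring.
have inth : mu.-integrable setT (EFin \o h) by [].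
have intsh : mu.-integrable setT (EFin \o (fun x => s * h x)).
  have := laplace_integrableZ s fi; rewrite /laplace_integrable.
  by under [X in EFin \o X]eq_fun do rewrite -mulrA.
have intk : mu.-integrable setT (EFin \o k).
  have -> : EFin \o k = ((EFin \o (fun x => g x * E x)%R) \- (EFin \o (fun x => s * h x)%R))%E.
    by [].
  exact: integrableB.
have := integral_increment_eq0 inth intk (locally_absolutely_continuous_FTC lach mk hk).
rewrite /k RintegralB// RintegralZl// => /eqP; rewrite subr_eq0 => /eqP.
by [].
Qed.

End LaplaceDerivative.

(** * Null sets and one-sided continuity *)

Section LaplaceContinuity.
Context {R : realType}.
Local Notation mu := (@lebesgue_measure R).
Implicit Types (f g : R -> R) (s t x : R).

Import HBNNSimple.

(** Lebesgue measure is defined on Borel sets only, so a function equal almost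
    everywhere to a Borel function may fail to be measurable. The integral of a
    nonnegative function is a supremum over simple functions below it, and
    replacing such a simple function by zero on a Borel null set does not change
    its integral. *)
Lemma nnintegral_le_ae (f g : R -> \bar R) :
  {ae mu, forall x, f x = g x} -> (forall x, 0 <= f x)%E -> (forall x, 0 <= g x)%E ->
  (\int[mu]_x f x <= \int[mu]_x g x)%E.
Proof.
move=> [N [mN N0 subN]] f0 g0; rewrite !ge0_integralTE//.
apply: ge_ereal_sup => _ [h hf <-].
have mNc : measurable (~` N) by exact: measurableC.
pose h' := proj_nnsfun h mNc.
have h'E x : h' x = if x \in N then 0 else h x.
  by rewrite /h' /= mindicE in_setC; case: (x \in N); rewrite ?mulr0 ?mulr1.
have <- : sintegral mu h' = sintegral mu h.
  have E (k : {nnsfun (measurableTypeR R) >-> R}) : sintegral mu k = (\int[mu]_x (k x)%:E)%E.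
    by rewrite integralT_nnsfun.
  rewrite !E; apply: ae_eq_integral => //.
  - exact/measurable_EFinP.
  - exact/measurable_EFinP.
  exists N; split => // x /=; apply: contra_notP => xN _.
  by congr (_%:E); apply: (etrans (h'E x)); rewrite ifF//; apply/negP => /set_mem.
apply: ereal_sup_ubound; exists h' => // x; have -> := h'E x.
case: ifPn => xN; first exact: g0.
have <- : f x = g x.
  by apply: contrapT => fg; move/negP: xN; apply; apply: mem_set; apply: (subN x); exact: fg.
exact: hf.
Qed.

Lemma Rintegral_ae_eq f g : {ae mu, forall x, f x = g x} ->
  \int[mu]_x f x = \int[mu]_x g x.
Proof.
have ge0 (u v : R -> \bar R) : {ae mu, forall x, u x = v x} ->
    (forall x, 0 <= u x)%E -> (forall x, 0 <= v x)%E ->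
    (\int[mu]_x u x = \int[mu]_x v x)%E.
  move=> uv u0 v0; apply/eqP; rewrite eq_le !nnintegral_le_ae//.
  by apply: ae_imp uv => x ->.
move=> fg; rewrite /Rintegral integralE [in RHS]integralE; congr (fine (_ - _)%E).
  apply: ge0 => //; apply: ae_imp fg => x fgx; by rewrite !funeposE /= fgx.
apply: ge0 => //; apply: ae_imp fg => x fgx; by rewrite !funenegE /= fgx.
Qed.

Lemma Laplace_ae_eq f g : {ae mu, forall x, f x = g x} -> Laplace f = Laplace g.
Proof.
move=> fg; apply/funext => s; rewrite /Laplace; apply: Rintegral_ae_eq.
by apply: ae_imp fg => x ->.
Qed.

Lemma laplace_integrable_ae_eq f g s : {ae mu, forall x, f x = g x} ->
  measurable_fun setT g -> laplace_integrable f s -> laplace_integrable g s.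
Proof.
move=> fg mg fi; apply/integrableP; split.
  by apply/measurable_EFinP; apply: measurable_funM => //; exact: measurable_expR_lin.
move/integrableP : (fi) => [mf]; congr (_ < _)%E.
apply: ge0_ae_eq_integral => //.
- exact: measurableT_comp.
- apply: measurableT_comp => //.
  by apply/measurable_EFinP; apply: measurable_funM => //; exact: measurable_expR_lin.
- by apply: ae_imp fg => x fgx _ /=; rewrite fgx.
Qed.

(** At an endpoint of the interval of convergence the transform is continuous
    from inside: the two extreme exponentials dominate all those in between. *)
Lemma Laplace_left_continuous f s1 s : s1 < s ->
  laplace_integrable f s1 -> laplace_integrable f s ->
  Laplace f t @[t --> s^'-] --> Laplace f s.
Proof.
move=> s1s i1 i2; have mf := laplace_integrable_measurable i1.
apply/cvg_at_leftP => t [tlt ts].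
suff H (u : nat -> R) : (forall n, s1 < u n) -> (forall n, u n < s) ->
    u n @[n --> \oo] --> s -> Laplace f (u n) @[n --> \oo] --> Laplace f s.
  have [N _ HN] : \forall n \near \oo, s1 < t n.
    by apply: (cvgr_gt s).
  rewrite -(cvg_shiftn N); apply: H.
  - by move=> n; apply: HN; rewrite /= leq_addl.
  - by move=> n; exact: tlt.
  - by rewrite cvg_shiftn.
move=> s1u us cu.
have mk r : measurable_fun setT (fun x => (f x * expR (- (r * x)))%:E).
  by apply/measurable_EFinP; apply: measurable_funM => //; exact: measurable_expR_lin.
have ck : {ae mu, forall x, setT x ->
    (f x * expR (- (u n * x)))%:E @[n --> \oo] --> (f x * expR (- (s * x)))%:E}.
  apply: aeW => x _; apply: cvg_EFin; first exact: nearW.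
  apply: cvgM; first exact: cvg_cst.
  apply: continuous_cvg; first exact: continuous_expR.
  by apply: cvgN; apply: cvgM => //; exact: cvg_cst.
have dk : {ae mu, forall x n, setT x -> (`|(f x * expR (- (u n * x)))%:E| <=
    (1 * `|f x| * (expR (- (s1 * x)) + expR (- (s * x))))%:E)%E}.
  apply: aeW => x n _; rewrite abse_EFin lee_fin normrM mul1r ler_wpM2l//.
  rewrite ger0_norm ?expR_ge0//; apply: expR_between.
  by rewrite (ltW (s1u n)) (ltW (us n)).
have [_ _ lim] := @dominated_convergence _ _ _ mu _ measurableT
  (fun n x => (f x * expR (- (u n * x)))%:E) _ _ (fun n => mk (u n)) (mk s) ck
  (laplace_moment_majorant 1 i1 i2) dk.
apply: fine_cvg.
have -> : (\int[mu]_x (f x * expR (- (s * x))))%:E = (\int[mu]_x (f x * expR (- (s * x)))%:E)%E.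
  by rewrite fineK//; exact: integrable_fin_num.
exact: lim.
Qed.

End LaplaceContinuity.

(** * The step line *)

Section StepLineCombinatorics.
Variable r : nat.
Hypothesis r_gt0 : (0 < r)%N.

(** The number of [k] with [k * r + j < m]: going along the step line, the
    coordinates are incremented cyclically, starting with the first one. *)
Definition step_index (m : nat) (j : 'I_r) : nat := (m + (r - j.+1)) %/ r.

Lemma step_index_step_line m : step_line (step_index m).
Proof.
move=> i j ij; rewrite /step_index; apply/andP; split.
  by apply: leq_div2r; rewrite leq_add2l leq_sub2l.
have <- : ((m + (r - j.+1) + r) %/ r = ((m + (r - j.+1)) %/ r).+1)%N.
  by rewrite divnDr ?dvdnn// divnn r_gt0 addn1.
apply: leq_div2r; rewrite -addnA leq_add2l.
by apply: leq_trans (leq_addl _ _); exact: leq_subr.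
Qed.

Lemma step_index_norm m : mi_norm (step_index m) = m.
Proof.
rewrite /mi_norm /step_index.
have -> : (\sum_(j < r) (m + (r - j.+1)) %/ r = \sum_(j < r) (m + j) %/ r)%N.
  by rewrite (reindex_inj rev_ord_inj) /=; apply: eq_bigr => j _; rewrite subnSK ?subKn // ltnW.
elim: m => [|m ih]; first by rewrite big1// => j _; rewrite add0n divn_small.
have E (a : nat) : (\sum_(j < r) (a + j) %/ r = \sum_(a <= j < a + r) j %/ r)%N.
  rewrite -[X in \sum_(X <= _ < _) _]add0n big_addn addKn big_mkord.
  by apply: eq_bigr => j _; rewrite addnC.
rewrite E in ih; rewrite E addSn.
have : (\sum_(m <= j < (m + r).+1) j %/ r = m + (m %/ r).+1)%N.
  rewrite big_nat_recr/=; last by rewrite leq_addr.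
  by rewrite ih divnDr ?dvdnn// divnn r_gt0 addn1.
rewrite big_ltn; last by rewrite ltnS leq_addr.
by set S := (\sum_(_ <= _ < _) _)%N; rewrite addnS => E1; rewrite -/S; lia.
Qed.

Lemma leq_step_index m m' j : (m <= m')%N -> (step_index m j <= step_index m' j)%N.
Proof. by move=> mm; apply: leq_div2r; rewrite leq_add2r. Qed.

Lemma step_indexDr m j : step_index (m + r) j = (step_index m j).+1.
Proof.
by rewrite /step_index addnAC divnDr ?dvdnn// divnn r_gt0 addn1.
Qed.

(** Two points of the step line are comparable coordinatewise: if one exceeds the
    other in coordinate [i] and is exceeded in coordinate [j], then one of them
    drops by at least two between these coordinates. *)
Lemma step_line_unique (nu nv : 'I_r -> nat) : step_line nu -> step_line nv ->
  mi_norm nu = mi_norm nv -> nu = nv.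
Proof.
move=> su sv; rewrite /mi_norm => E.
have cmp (u v : 'I_r -> nat) : step_line u -> step_line v ->
    (\sum_j u j = \sum_j v j)%N -> forall i, (u i <= v i)%N.
  move=> hu hv Euv i; rewrite leqNgt; apply/negP => vi.
  suff H j : (v j <= u j)%N.
    have : (\sum_j v j < \sum_j u j)%N.
      rewrite (bigD1 i) //= [X in (_ < X)%N](bigD1 i) //= -addSn.
      by apply: leq_add => //; exact: leq_sum.
    by rewrite Euv ltnn.
  rewrite leqNgt; apply/negP => uj.
  case: (leqP i j) => [ij|/ltnW ji].
    by have /andP[] := hu _ _ ij; have /andP[] := hv _ _ ij; lia.
  by have /andP[] := hu _ _ ji; have /andP[] := hv _ _ ji; lia.
apply/funext => i; apply/eqP; rewrite eqn_leq (cmp _ _ su sv E).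
by rewrite (cmp _ _ sv su (esym E)).
Qed.

End StepLineCombinatorics.

(** * Spans modulo null sets *)

Section Spans.
Context {R : realType}.
Local Notation mu := (@lebesgue_measure R).
Implicit Types (I : finType) (f g : R -> R).

Lemma ae_forall_fin (I : finType) (P : I -> R -> Prop) :
  (forall i, {ae mu, forall x, P i x}) -> {ae mu, forall x, forall i, P i x}.
Proof.
move=> H.
have : {ae mu, forall x, forall k : nat, forall i : I, (enum_rank i : nat) = k -> P i x}.
  apply: ae_foralln => k.
  have [[i ik]|nk] := pselect (exists i : I, (enum_rank i : nat) = k); last first.
    by apply: aeW => x i ik; exfalso; apply: nk; exists i.
  apply: (ae_imp _ (H i)) => x Pi j jk.
  have -> // : j = i by apply: enum_rank_inj; apply: val_inj; rewrite /= ik.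
by apply: ae_imp => x Hx i; apply: (Hx _ _ erefl).
Qed.

Lemma in_span_mem (I : finType) (v : I -> R -> R) i : in_span v (v i).
Proof.
exists (fun j => (j == i)%:R); apply: aeW => x.
rewrite (bigD1 i) //= eqxx mul1r big1 ?addr0// => j /negbTE ->.
by rewrite mul0r.
Qed.

Lemma in_span_trans (I J : finType) (v : I -> R -> R) (u : J -> R -> R) f :
  (forall i, in_span u (v i)) -> in_span v f -> in_span u f.
Proof.
move=> /choice[C HC] [c cE]; exists (fun j => \sum_i c i * C i j).
apply: ae_imp2 (ae_forall_fin HC) cE => x Hx ->.
under eq_bigr do rewrite Hx mulr_sumr.
rewrite exchange_big /=; apply: eq_bigr => j _; rewrite mulr_suml.
by apply: eq_bigr => i _; rewrite mulrA.
Qed.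

Lemma in_span_mulx (I J : finType) (v : I -> R -> R) (u : J -> R -> R) f :
  (forall i, in_span u (fun x => x * v i x)) -> in_span v f ->
  in_span u (fun x => x * f x).
Proof.
move=> vu [c cE].
apply: (@in_span_trans I J (fun i x => x * v i x)) => //.
exists c; apply: ae_imp cE => x ->.
by rewrite mulr_sumr; apply: eq_bigr => i _; rewrite mulrCA.
Qed.

Variables (r : nat) (w : 'I_r -> R -> R).

Lemma W_family_sub (mv mv' : 'I_r -> nat) : (forall j, (mv j <= mv' j)%N) ->
  forall i, exists i', W_family w mv i = W_family w mv' i'.
Proof.
move=> le_mv [j k]; have lt_k : (k < mv' j)%N by exact: leq_trans (le_mv j).
by exists (Tagged (fun j => 'I_(mv' j)) (Ordinal lt_k)).
Qed.

Lemma in_span_W_sub (mv mv' : 'I_r -> nat) f : (forall j, (mv j <= mv' j)%N) ->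
  in_span (W_family w mv) f -> in_span (W_family w mv') f.
Proof.
move=> le_mv; apply: in_span_trans => i.
have [i' ->] := W_family_sub le_mv i; exact: in_span_mem.
Qed.

Lemma in_span_W_mulx (mv mv' : 'I_r -> nat) f : (forall j, (mv j < mv' j)%N) ->
  in_span (W_family w mv) f -> in_span (W_family w mv') (fun x => x * f x).
Proof.
move=> lt_mv; apply: in_span_mulx => -[j k].
have lt_k : (k.+1 < mv' j)%N by exact: leq_ltn_trans (lt_mv j).
have -> : (fun x => x * W_family w mv (Tagged (fun j => 'I_(mv j)) k) x) =
    W_family w mv' (Tagged (fun j => 'I_(mv' j)) (Ordinal lt_k)).
  by apply/funext => x; rewrite /W_family /= mulrA exprS.
exact: in_span_mem.
Qed.

Lemma card_W_family (mv : 'I_r -> nat) : #|{: {j : 'I_r & 'I_(mv j)}}| = mi_norm mv.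
Proof.
by rewrite card_tagged sumnE big_map big_enum /=; apply: eq_bigr => j _; rewrite card_ord.
Qed.

End Spans.

(** * Families of additive derivative type under the transform *)

Section DerivativeTypeLaplace.
Context {R : realType}.
Local Notation mu := (@lebesgue_measure R).
Variables (I : finType) (v : I -> R -> R) (om : R -> R).
Hypothesis typ : additive_derivative_type_wrt v om.

Lemma type_in_span j : (j < #|I|)%N -> in_span v (derive1n j om).
Proof.
move=> jI; apply/(typ.2 _).2.
exact: (in_span_mem (fun j : 'I_#|I| => derive1n j om) (Ordinal jI)).
Qed.

Lemma type_continuous j : (j.+1 < #|I|)%N -> continuous (derive1n j om).
Proof.
move=> jI; have [|[dj cj] _] := typ.1; first exact: leq_trans jI.
move=> x; have : (j <= #|I| - 2)%N by lia.
rewrite leq_eqVlt => /predU1P[->|jn]; first exact: cj.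
by apply: differentiable_continuous; apply/derivable1_diffP; exact: dj.
Qed.

Lemma type_lac j : (j.+1 < #|I|)%N -> locally_absolutely_continuous (derive1n j om).
Proof.
move=> jI; have [|[dj cj] lac] := typ.1; first exact: leq_trans jI.
have : (j <= #|I| - 2)%N by lia.
rewrite leq_eqVlt => /predU1P[->//|jn].
apply: C1_locally_absolutely_continuous; first exact: dj.
by rewrite -derive1nS; apply: type_continuous; lia.
Qed.

(** All derivatives but the last are continuous, hence measurable. The last one
    exists only almost everywhere and is handled through the combination of
    the [v i] to which it is almost everywhere equal. *)
Lemma type_Laplace s j : (forall i, laplace_integrable (v i) s) -> (j < #|I|)%N ->
  Laplace (derive1n j om) s = s ^+ j * Laplace om s.
Proof.
move=> vi; elim: j => [|j ih] jI; first by rewrite expr0 mul1r.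
have jI' := ltnW jI.
have [c cE] := type_in_span jI'; have [d dE] := type_in_span jI.
pose f := derive1n j om; pose g x := \sum_i d i * v i x.
have gi : laplace_integrable g s by exact: laplace_integrable_sum.
have fi : laplace_integrable f s.
  apply: (@laplace_integrable_ae_eq _ (fun x => \sum_i c i * v i x)).
  - by apply: ae_imp cE => x.
  - by apply: continuous_measurable_fun; exact: type_continuous.
  - exact: laplace_integrable_sum.
rewrite (Laplace_ae_eq dE) -/g (@Laplace_derivative _ f g) //.
- by rewrite ih// mulrA exprS.
- exact: type_lac.
Qed.

(** The transforms of the span are the polynomials of degree less than [#|I|]
    times the transform of [om]. *)
Lemma span_Laplace f : in_span v f -> exists2 a : {poly R}, (size a <= #|I|)%N &
  forall s, (forall i, laplace_integrable (v i) s) ->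
    Laplace f s = a.[s] * Laplace om s.
Proof.
move=> /typ.2 [c cE]; exists (\poly_(j < #|I|) (if insub j is Some j' then c j' else 0)).
  exact: size_poly.
move=> s vi.
have /choice[C HC] : forall j : 'I_#|I|, exists d, {ae mu, forall x,
    derive1n j om x = \sum_i d i * v i x}.
  by move=> j; exact: (type_in_span (ltn_ord j)).
have fE : {ae mu, forall x, f x = \sum_j c j * (\sum_i C j i * v i x)}.
  apply: ae_imp2 (ae_forall_fin HC) cE => x Hx ->.
  by apply: eq_bigr => j _; rewrite Hx.
rewrite (Laplace_ae_eq fE) Laplace_sum; last first.
  by move=> j; exact: laplace_integrable_sum.
rewrite horner_poly mulr_suml; apply: eq_bigr => j _.
rewrite valK -mulrA; congr (_ * _).
by rewrite -(Laplace_ae_eq (HC j)) type_Laplace.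
Qed.

End DerivativeTypeLaplace.

(** * Derivatives of a reciprocal *)

Section Leibniz.
Context {R : realType}.

(** Differentiating a Leibniz sum of order [N] produces the one of order
    [N + 1]. *)
Lemma pascal_sum (N : nat) (a b : nat -> R) :
  \sum_(k < N.+1) 'C(N, k)%:R * (a k.+1 * b (N - k)%N + a k * b (N - k).+1) =
  \sum_(k < N.+2) 'C(N.+1, k)%:R * (a k * b (N.+1 - k)%N).
Proof.
under eq_bigr do rewrite mulrDr.
rewrite big_split /= addrC.
rewrite [in RHS]big_ord_recl /= bin0 subn0 [X in X + _ = _]big_ord_recl /= bin0 subn0.
rewrite -addrA; congr (_ + _).
under [in RHS]eq_bigr => i _ do
  rewrite /bump /= add1n binS natrD mulrDl subSS.
rewrite big_split /=; congr (_ + _).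
rewrite [RHS]big_ord_recr /= bin_small// mul0r addr0.
by apply: eq_bigr => i _; rewrite /bump /= add1n subnSK.
Qed.

(** The Leibniz formula for [M 0 * (M 0)^-1 = 1]. Identity and differentiability
    are proved together: the identity of order [N + 1] expresses the derivative of
    order [N + 1] of the reciprocal through lower ones, so that it is again
    differentiable. *)
Lemma derive1n_inv (M : nat -> R -> R) (O : set R) : open O ->
  (forall k s, O s -> is_derive s 1 (M k) (M k.+1 s)) ->
  (forall s, O s -> M 0%N s != 0) ->
  forall N s, O s -> \sum_(k < N.+1) 'C(N, k)%:R *
      (M k s * derive1n (N - k) (fun s => (M 0%N s)^-1) s) = (N == 0%N)%:R.
Proof.
move=> oO dM M0; set V := fun N => derive1n N (fun s => (M 0%N s)^-1).
suff H N : (forall s, O s -> \sum_(k < N.+1) 'C(N, k)%:R *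
      (M k s * V (N - k)%N s) = (N == 0%N)%:R) /\
   (forall j s, (j <= N)%N -> O s -> derivable (V j) s 1).
  by move=> N s Os; have [-> //] := H N.
elim: N => [|N [idN dV]].
  split=> [s Os|j s]; first by rewrite big_ord1 /= bin0 mul1r mulfV// M0.
  rewrite leqn0 => /eqP -> Os.
  by apply: derivableV; [exact: M0|case: (dM 0%N s Os)].
have idV j s : (j <= N)%N -> O s -> is_derive s 1 (V j) (V j.+1 s).
  by move=> jN Os; split; [exact: dV|rewrite /V derive1nS derive1E].
have idN1 s : O s -> \sum_(k < N.+2) 'C(N.+1, k)%:R *
      (M k s * V (N.+1 - k)%N s) = (N.+1 == 0%N)%:R.
  move=> Os; rewrite -(pascal_sum N (M^~ s) (V^~ s)) /=.
  pose g (k : 'I_N.+1) := 'C(N, k)%:R \*: (M k * V (N - k)%N).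
  have dg : is_derive s 1 (\sum_(k < N.+1) g k)
    (\sum_(k < N.+1) 'C(N, k)%:R * (M k.+1 s * V (N - k)%N s + M k s * V (N - k).+1 s)).
    apply: is_derive_sum => k; rewrite /g.
    have d1 := dM k s Os; have d2 := idV (N - k)%N s (leq_subr _ _) Os.
    apply: is_derive_eq; rewrite /GRing.scale /=; ring.
  have dc : is_derive s 1 (\sum_(k < N.+1) g k) 0.
    have d0 : is_derive s 1 (cst (N == 0%N)%:R : R -> R) 0 by exact: is_derive_cst.
    apply: near_eq_is_derive d0.
    near=> t; have Ot : O t by near: t; exact: open_nbhs_nbhs.
    by rewrite fct_sumE /= /cst -(idN t Ot).
  by case: dg => _ <-; case: dc => _ ->.
split => // j s; rewrite leq_eqVlt => /orP[/eqP ->|jN] Os; last exact: dV.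
have near_der (f g : R -> R) : (\near s, f s = g s) -> derivable f s 1 -> derivable g s 1.
  exact: near_eq_derivable.
pose h (k : 'I_N.+1) := ('C(N.+1, k.+1)%:R \*: (M k.+1 * V (N - k)%N)).
apply: (@near_der (- ((fun s => (M 0%N s)^-1) * \sum_(k < N.+1) h k))).
  near=> t; have Ot : O t by near: t; exact: open_nbhs_nbhs.
  have := idN1 t Ot; rewrite big_ord_recl /= bin0 ?subn0 mul1r => /eqP.
  rewrite addr_eq0 => /eqP E.
  have -> : derive1 (V N) t = (M 0%N t)^-1 * (M 0%N t * derive1 (V N) t) by rewrite mulKf ?M0.
  rewrite E mulrN; congr (- (_ * _)); rewrite fct_sumE; apply: eq_bigr => k _.
  by rewrite /bump /= add1n subSS.
apply: derivableN; apply: derivableM.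
  by apply: derivableV; [exact: M0|case: (dM 0%N s Os)].
apply: derivable_sum => k; apply: derivableZ; apply: derivableM.
  by case: (dM k.+1 s Os).
by apply: dV => //; exact: leq_subr.
Unshelve. all: by end_near. Qed.

End Leibniz.

(** * Appell polynomials *)

Section Appell.
Context {R : realFieldType}.
Variables (n : nat) (m u : nat -> R).
Hypothesis n_gt0 : (0 < n)%N.

Definition moment_functional (p : {poly R}) := \sum_(k < size p) p`_k * m k.
Local Notation L := moment_functional.

Lemma moment_functionalE N (p : {poly R}) : (size p <= N)%N ->
  L p = \sum_(k < N) p`_k * m k.
Proof.
move=> pN; rewrite /L (big_ord_widen _ (fun k => p`_k * m k) pN) big_mkcond /=.
apply: eq_bigr => k _; case: ltnP => // kp.
by rewrite nth_default// mul0r.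
Qed.

Lemma moment_functionalD p q : L (p + q) = L p + L q.
Proof.
pose N := maxn (size p) (size q).
rewrite (@moment_functionalE N (p + q)) ?size_polyD//.
rewrite (@moment_functionalE N p) ?leq_maxl// (@moment_functionalE N q) ?leq_maxr//.
by rewrite -big_split; apply: eq_bigr => k _; rewrite coefD mulrDl.
Qed.

Lemma moment_functionalZ c p : L (c *: p) = c * L p.
Proof.
rewrite (@moment_functionalE (size p) (c *: p)) ?size_scale_leq//.
by rewrite /L mulr_sumr; apply: eq_bigr => k _; rewrite coefZ mulrA.
Qed.

Lemma moment_functionalC c : L c%:P = c * m 0%N.
Proof. by rewrite (@moment_functionalE 1) ?size_polyC_leq1// big_ord1 coefC. Qed.

(** Orthogonality of [P] to the derivatives of a weight with moments [m], after
    integration by parts has moved the derivatives to [P]. *)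
Definition appell_conditions (P : {poly R}) :=
  [/\ P \is monic, size P = n.+1 & forall j, (j < n)%N -> L P^`(j) = 0].

Definition appell_poly N : {poly R} :=
  \sum_(k < N.+1) ((-1) ^+ (N - k) * 'C(N, k)%:R * u (N - k)%N) *: 'X^k.

Lemma appell_polyE N : appell_poly N =
  \poly_(k < N.+1) ((-1) ^+ (N - k) * 'C(N, k)%:R * u (N - k)%N).
Proof. by rewrite poly_def. Qed.

Lemma coef_appell_poly N k : (k <= N)%N ->
  (appell_poly N)`_k = (-1) ^+ (N - k) * 'C(N, k)%:R * u (N - k)%N.
Proof.
by move=> kN; rewrite appell_polyE coef_poly ltnS kN.
Qed.

Lemma size_appell_poly N : (size (appell_poly N) <= N.+1)%N.
Proof. by rewrite appell_polyE size_poly. Qed.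

Lemma deriv_appell_poly N : (appell_poly N.+1)^`() = N.+1%:R *: appell_poly N.
Proof.
apply/polyP => k; rewrite coef_deriv coefZ.
have [kN|kN] := leqP k N; last first.
  rewrite !nth_default ?mulr0 ?mul0rn//.
    exact: leq_trans (size_appell_poly _) _.
  exact: leq_trans (size_appell_poly _) _.
rewrite !coef_appell_poly// subSS -[LHS]mulr_natl.
have : (k.+1 * 'C(N.+1, k.+1) = N.+1 * 'C(N, k))%N by rewrite mul_bin_diag.
move/(congr1 (fun i => i%:R : R)); rewrite !natrM => E.
rewrite mulrA mulrCA E [RHS]mulrA [N.+1%:R * (_ * _)]mulrCA.
by [].
Qed.

Lemma derivn_appell_poly j N : (j <= N)%N ->
  exists c, (appell_poly N)^`(j) = c *: appell_poly (N - j).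
Proof.
elim: j => [|j ih] jN; first by exists 1; rewrite derivn0 subn0 scale1r.
have [c E] := ih (ltnW jN); exists (c * (N - j)%:R).
by rewrite derivnS E derivZ -subnSK// deriv_appell_poly scalerA.
Qed.

Hypothesis mu_inv : m 0%N != 0 -> forall N, (N <= n)%N ->
  \sum_(k < N.+1) 'C(N, k)%:R * ((-1) ^+ k * m k * u (N - k)%N) = (N == 0%N)%:R.

Lemma moment_functional_appell N : m 0%N != 0 -> (N <= n)%N ->
  L (appell_poly N) = (N == 0%N)%:R.
Proof.
move=> m0 Nn; rewrite (@moment_functionalE N.+1) ?size_appell_poly//.
transitivity ((-1) ^+ N * \sum_(k < N.+1) 'C(N, k)%:R * ((-1) ^+ k * m k * u (N - k)%N)).
  rewrite mulr_sumr; apply: eq_bigr => k _; rewrite coef_appell_poly -1?ltnS//.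
  have -> : (-1) ^+ (N - k) = (-1) ^+ N * (-1) ^+ k :> R.
    by rewrite -signr_odd oddB -1?ltnS// signr_addb !signr_odd.
  ring.
rewrite mu_inv//; by case: N {Nn} => [|N]; rewrite ?mulr0 ?mulr1 ?expr0.
Qed.

(** If [m 0 = 0] the functional kills constants, so [P + 1] is a solution along
    with [P]. If [m 0 != 0] and the difference [D] of two solutions has degree
    [e < n], its derivative of order [e] is a nonzero constant, which the
    functional does not kill. *)
Theorem appell_unique P :
  unique appell_conditions P <-> m 0%N <> 0 /\ P = m 0%N *: appell_poly n.
Proof.
have A0 : m 0%N != 0 -> appell_conditions (m 0%N *: appell_poly n).
  move=> m0; have u0 : m 0%N * u 0%N = 1.
    by have := mu_inv m0 (leq0n n); rewrite big_ord1 bin0 expr0 !mul1r.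
  have cn : (m 0%N *: appell_poly n)`_n = 1.
    by rewrite coefZ coef_appell_poly// subnn expr0 binn !mul1r.
  have sz : size (m 0%N *: appell_poly n) = n.+1.
    apply/eqP; rewrite eqn_leq (leq_trans (size_scale_leq _ _) (size_appell_poly n)) /=.
    rewrite ltnNge; apply/negP => h; move: cn; rewrite nth_default// => /eqP.
    by rewrite eq_sym oner_eq0.
  split => //; first by rewrite monicE lead_coefE sz cn.
  move=> j jn; rewrite derivnZ moment_functionalZ.
  have [c ->] := derivn_appell_poly (ltnW jn).
  rewrite moment_functionalZ moment_functional_appell ?leq_subr//.
  by rewrite subn_eq0 leqNgt jn !mulr0.
split=> [[[Pm Ps PL] Pu]|[/eqP m0 ->]]; last first.
  split; first exact: A0.
  move=> Q [Qm Qs QL]; have [Am As AL] := A0 m0.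
  set A := _ *: _ in Am As AL *.
  apply/eqP; rewrite -subr_eq0; apply/negPn/negP => D0.
  set D := A - Q in D0.
  have Dn : (size D <= n)%N.
    apply/leq_sizeP => k; rewrite leq_eqVlt => /orP[/eqP <-|nk].
      rewrite coefB; move: Am Qm; rewrite !monicE !lead_coefE As Qs /= => /eqP -> /eqP ->.
      by rewrite subrr.
    by rewrite coefB !nth_default ?subrr// ?As ?Qs.
  have DL j : (j < n)%N -> L D^`(j) = 0.
    move=> jn; rewrite derivnB moment_functionalD AL// -scaleN1r.
    by rewrite moment_functionalZ QL// mulr0 addr0.
  have sD : (0 < size D)%N by rewrite lt0n size_poly_eq0.
  have := DL (size D).-1; rewrite prednK// => /(_ Dn).
  have -> : D^`((size D).-1) = (lead_coef D *+ (size D).-1`!)%:P.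
    apply/polyP => k; rewrite coef_derivn coefC; case: k => [|k] /=.
      by rewrite addn0 lead_coefE ffactnn.
    by rewrite nth_default ?mul0rn// -{1}(prednK sD) -addn1 leq_add2l.
  rewrite moment_functionalC => /eqP; rewrite mulf_eq0 (negbTE m0) orbF.
  by rewrite mulrn_eq0 lead_coef_eq0 (negbTE D0) orbF eqn0Ngt fact_gt0.
have m0 : m 0%N != 0.
  apply/negP => /eqP m0.
  have : P = P + 1%:P.
    apply: Pu; split.
    - rewrite monicE lead_coefDl ?(monicP Pm)//.
      by rewrite Ps size_polyC oner_eq0 ltnS.
    - by rewrite size_polyDl Ps// size_polyC oner_eq0 ltnS.
    - move=> j jn; rewrite derivnD moment_functionalD PL// add0r.
      case: j {jn} => [|j]; first by rewrite derivn0 moment_functionalC m0 mulr0.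
      by rewrite derivnC /= -(scale0r 0) moment_functionalZ mul0r.
  move/eqP; rewrite -subr_eq0 opprD addrA subrr add0r oppr_eq0 polyC_eq0.
  by rewrite oner_eq0.
split; first exact/eqP.
by apply: Pu; exact: A0.
Qed.

End Appell.

(** * Moments *)

Section Moments.
Context {R : realType}.
Local Notation mu := (@lebesgue_measure R).
Implicit Types (f g : R -> R) (s x : R) (p : {poly R}).

Definition laplace_moment f s (k : nat) := Laplace (fun x => x ^+ k * f x) s.

Lemma laplace_moment0 f s : laplace_moment f s 0 = Laplace f s.
Proof.
by rewrite /laplace_moment; congr Laplace; apply/funext => x; rewrite expr0 mul1r.
Qed.

Lemma laplace_moment_derive f s k : locally_laplace_integrable f s ->
  is_derive s 1 (laplace_moment f ^~ k) (- laplace_moment f s k.+1).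
Proof.
move=> fi; have := is_derive_Laplace (locally_laplace_pow k fi).
rewrite /laplace_moment; set d := Laplace _ s; set e := Laplace _ s.
have -> // : d = e.
by rewrite /d /e; congr Laplace; apply/funext => x; rewrite mulrA exprS.
Qed.

(** Differentiate the identity [L g = s L f] repeatedly in [s]. At [s = 0] this is
    integration by parts against monomials. *)
Lemma laplace_moment_derivative (O : set R) f g : open O ->
  (forall s, O s -> locally_laplace_integrable f s) ->
  (forall s, O s -> locally_laplace_integrable g s) ->
  (forall s, O s -> Laplace g s = s * Laplace f s) ->
  forall k s, O s -> laplace_moment g s k =
    s * laplace_moment f s k - k%:R * laplace_moment f s k.-1.
Proof.
move=> oO fi gi gf; elim=> [|k ih] s Os.
  by rewrite !laplace_moment0 mul0r subr0 gf.
have d1 := laplace_moment_derive k (gi s Os).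
have d2 := laplace_moment_derive k (fi s Os).
have d3 := laplace_moment_derive k.-1 (fi s Os).
have d5 : is_derive s 1 (id * (laplace_moment f ^~ k) - k%:R \*: (laplace_moment f ^~ k.-1))
   (laplace_moment f s k - s * laplace_moment f s k.+1 + k%:R * laplace_moment f s k).
  apply: is_derive_eq; rewrite /GRing.scale /=.
  by case: k {ih d1 d2 d3} => [|k] /=; ring.
have d4 : is_derive s 1 (id * (laplace_moment f ^~ k) - k%:R \*: (laplace_moment f ^~ k.-1))
   (- laplace_moment g s k.+1).
  apply: near_eq_is_derive d1; near=> t.
  have Ot : O t by near: t; exact: open_nbhs_nbhs.
  by rewrite (ih t Ot).
have E : - laplace_moment g s k.+1 =
    laplace_moment f s k - s * laplace_moment f s k.+1 + k%:R * laplace_moment f s k.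
  by case: d4 => _ <-; case: d5 => _ ->.
by rewrite -[LHS]opprK E -natr1 /=; ring.
Unshelve. all: by end_near. Qed.

Definition moment_pairing p f := Laplace (fun x => p.[x] * f x) 0.

Lemma moment_pairingE p f : locally_laplace_integrable f 0 ->
  moment_pairing p f = moment_functional (laplace_moment f 0) p.
Proof.
move=> fi; rewrite /moment_pairing /moment_functional.
have -> : (fun x => p.[x] * f x) =
    (fun x => \sum_(k < size p) p`_k * (x ^+ k * f x)).
  apply/funext => x; rewrite horner_coef mulr_suml.
  by apply: eq_bigr => k _; rewrite mulrA.
rewrite Laplace_sum// => k; apply: locally_laplace_at.
exact: locally_laplace_pow.
Qed.

Lemma moment_pairing_sum (I : finType) (c : I -> R) (v : I -> R -> R) p f :
  (forall i, locally_laplace_integrable (v i) 0) ->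
  {ae mu, forall x, f x = \sum_i c i * v i x} ->
  moment_pairing p f = \sum_i c i * moment_pairing p (v i).
Proof.
move=> vi fE; rewrite /moment_pairing.
have pfE : {ae mu, forall x, p.[x] * f x = \sum_i c i * (p.[x] * v i x)}.
  apply: ae_imp fE => x ->; rewrite mulr_sumr.
  by apply: eq_bigr => i _; rewrite mulrCA.
rewrite (Laplace_ae_eq pfE) Laplace_sum// => i.
have -> : (fun x => p.[x] * v i x) =
    (fun x => \sum_(k < size p) p`_k * (x ^+ k * v i x)).
  apply/funext => x; rewrite horner_coef mulr_suml.
  by apply: eq_bigr => k _; rewrite mulrA.
apply: laplace_integrable_sum => k; apply: locally_laplace_at.
exact: locally_laplace_pow.
Qed.

Lemma moment_functional_derivative (m m' : nat -> R) :
  (forall k, m' k = - (k%:R * m k.-1)) ->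
  forall p, moment_functional m' p = - moment_functional m p^`().
Proof.
move=> mm' p.
rewrite (moment_functionalE m (N := (size p).-1)); last exact: size_poly.
rewrite (moment_functionalE m' (N := (size p).-1.+1)) ?leqSpred// -sumrN.
rewrite big_ord_recl mm' mul0r oppr0 mulr0 add0r.
apply: eq_bigr => k _; rewrite mm' coef_deriv -[in RHS]mulr_natr lift0 /= ; ring.
Qed.

End Moments.

(** * Type II polynomials *)

Section TypeIIFormula.
Context {R : realType}.
Local Notation mu := (@lebesgue_measure R).

Lemma open_locally_laplace (J : finType) (f : J -> R -> R) :
  open [set s | forall j, locally_laplace_integrable (f j) s].
Proof.
rewrite openE => s /= fs.
apply: (@filter_forall _ _ (fun j => [set t | locally_laplace_integrable (f j) t])
  (nbhs s)) => j.
exact: locally_laplace_near.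
Qed.

Lemma Laplace_analytic_locally (f : R -> R) :
  Laplace_analytic_at0 f -> locally_laplace_integrable f 0.
Proof.
move=> [d d0 [fi _]]; exists (d / 2); first by rewrite divr_gt0.
move=> t; rewrite subr0 => td; apply: fi => /=.
by apply: (le_lt_trans td); rewrite ltr_pdivrMr// ltr_pMr// ltr1n.
Qed.

Variables (r : nat) (w : 'I_r -> R -> R) (nv : 'I_r -> nat) (n : nat) (om : R -> R).
Hypotheses (n_gt0 : (0 < n)%N) (nvn : mi_norm nv = n).
Hypothesis w0 : forall j, locally_laplace_integrable (w j) 0.
Hypothesis typ : additive_derivative_type_wrt (W_family w nv) om.

Local Notation I := {: {j : 'I_r & 'I_(nv j)}}.
Local Notation v := (W_family w nv).

Let cardI : #|I| = n. Proof. by rewrite card_W_family. Qed.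

Lemma locally_laplace_W i s : (forall j, locally_laplace_integrable (w j) s) ->
  locally_laplace_integrable (v i) s.
Proof. by move=> ws; exact: locally_laplace_pow. Qed.

Lemma typeII_conditions_pairing P : typeII_conditions w nv P <->
  [/\ P \is monic, size P = n.+1 & forall i : I, moment_pairing P (v i) = 0].
Proof.
have E (j : 'I_r) (k : nat) (kj : (k < nv j)%N) :
    \int[mu]_x (P.[x] * x ^+ k * w j x) =
    moment_pairing P (v (Tagged (fun j => 'I_(nv j)) (Ordinal kj))).
  rewrite /moment_pairing /Laplace; apply: eq_Rintegral => x _.
  by rewrite mul0r oppr0 expR0 mulr1 /W_family /= mulrA.
split=> -[Pm Ps H]; split=> //; rewrite ?nvn// -?nvn//.
  move=> [j k]; have := H j k (ltn_ord k); rewrite E.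
  by congr (moment_pairing P (v (existT _ _ _)) = _); exact: val_inj.
by move=> j k kj; rewrite E.
Qed.

(** The [v i] and the [g j], representatives of the derivatives of [om], span the
    same space, so the orthogonality conditions may be tested on the [g j], where
    they become the Appell conditions for the moments of [om]. *)
Theorem typeII_appell P : is_typeII_polynomial w nv P <->
     Laplace om 0 <> 0 /\
     P = Laplace om 0 *:
         \sum_(k < n.+1)
           ((-1) ^+ (n - k) * 'C(n, k)%:R *
            derive1n (n - k) (fun s => (Laplace om s)^-1) 0) *: 'X^k.
Proof.
have /choice[C HC] : forall j : 'I_n, exists d, {ae mu, forall x,
    derive1n j om x = \sum_i d i * v i x}.
  by move=> j; apply: (type_in_span typ); rewrite cardI.
pose g (j : 'I_n) x := \sum_i C j i * v i x.
pose O := [set s | forall j, locally_laplace_integrable (w j) s].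
have oO : open O by exact: open_locally_laplace.
have vO i s : O s -> locally_laplace_integrable (v i) s by exact: locally_laplace_W.
have gO j s : O s -> locally_laplace_integrable (g j) s.
  by move=> Os; apply: locally_laplace_sum => i; exact: vO.
have Lg j s : O s -> Laplace (g j) s = s ^+ j * Laplace om s.
  move=> Os; rewrite -(Laplace_ae_eq (HC j)) (type_Laplace typ) ?cardI// => i.
  by apply: locally_laplace_at; exact: vO.
pose j0 := Ordinal n_gt0.
pose m k := laplace_moment (g j0) 0 k.
pose u k := derive1n k (fun s => (Laplace om s)^-1) 0.
have m0 : m 0%N = Laplace om 0.
  by rewrite /m laplace_moment0 Lg ?expr0 ?mul1r.
have pair_g (j : 'I_n) P' : moment_pairing P' (g j) =
    (-1) ^+ j * moment_functional m P'^`(j).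
  rewrite moment_pairingE; last exact: gO.
  case: j => j jn; elim: j P' jn => [|j ih] P' jn.
    by rewrite expr0 mul1r derivn0; congr (moment_functional (laplace_moment (g _) 0) _); exact: val_inj.
  have jn' := ltnW jn.
  rewrite (@moment_functional_derivative _ (laplace_moment (g (Ordinal jn')) 0)).
    by rewrite ih -derivSn exprS mulN1r mulNr.
  move=> k; rewrite (laplace_moment_derivative oO (gO _) (gO _) _ _ _ (f := g (Ordinal jn'))) //.
    by rewrite mul0r add0r.
  by move=> s Os; rewrite !Lg //= exprS mulrA.
have condE P' : typeII_conditions w nv P' <-> appell_conditions n m P'.
  rewrite typeII_conditions_pairing; split=> -[Pm Ps H]; split=> //.
    move=> j jn; apply: (@mulfI _ ((-1) ^+ j)); first by rewrite signr_eq0.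
    rewrite mulr0 -(pair_g (Ordinal jn)).
    rewrite (@moment_pairing_sum _ _ (C (Ordinal jn)) v) ?big1// => [i _|i|].
    - by rewrite H mulr0.
    - exact: vO.
    - exact: aeW.
  move=> i; have [d dE] : in_span (fun j : 'I_#|I| => derive1n j om) (v i).
    by apply/typ.2; exact: in_span_mem.
  have {}dE : {ae mu, forall x, v i x = \sum_(j < n) d (cast_ord (esym cardI) j) * g j x}.
    apply: ae_imp2 (ae_forall_fin HC) dE => x Hx ->.
    rewrite (reindex (cast_ord (esym cardI))) /=; last first.
      by exists (cast_ord cardI) => j _; rewrite ?cast_ordK ?cast_ordKV.
    by apply: eq_bigr => j _; rewrite Hx.
  rewrite (moment_pairing_sum _ _ dE) => [|j]; last exact: gO.
  by rewrite big1// => j _; rewrite pair_g H ?mulr0 ?ltn_ord.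
have uniE : is_typeII_polynomial w nv P <-> unique (appell_conditions n m) P.
  by split=> -[/condE h1 h2]; split=> // Q /condE; exact: h2.
suff key : m 0%N != 0 -> forall N, (N <= n)%N ->
    \sum_(k < N.+1) 'C(N, k)%:R * ((-1) ^+ k * m k * u (N - k)%N) = (N == 0%N)%:R.
  by rewrite uniE (appell_unique n_gt0 key P) m0.
rewrite m0 => m00 N Nn.
(* [M k] is the derivative of order [k] of [L om]: each differentiation under the
   integral contributes a factor [- x]. *)
pose M k s := (-1) ^+ k * laplace_moment (g j0) s k.
have M0E : M 0%N = Laplace om.
  apply/funext => s; rewrite /M expr0 mul1r laplace_moment0.
  by rewrite -(Laplace_ae_eq (HC j0)).
pose O' := [set s | O s /\ M 0%N s != 0].
have dM k s : O s -> is_derive s 1 (M k) (M k.+1 s).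
  move=> Os; have d := laplace_moment_derive k (gO j0 s Os).
  have -> : M k = (-1) ^+ k \*: (laplace_moment (g j0) ^~ k) by [].
  by apply: is_derive_eq; rewrite /M /GRing.scale /= exprS; ring.
have oO' : open O'.
  rewrite openE => s [Os Ms]; apply: filterI; first by rewrite openE in oO; exact: oO.
  have cM : {for s, continuous (M 0%N)}.
    by apply: differentiable_continuous; apply/derivable1_diffP; case: (dM 0%N s Os).
  exact: cvgr_neq0 cM Ms.
have dM' k s : O' s -> is_derive s 1 (M k) (M k.+1 s) by move=> [Os _]; exact: dM.
have M0' s : O' s -> M 0%N s != 0 by case.
have := derive1n_inv oO' dM' M0' N (s := 0).
rewrite M0E => <-; last by split; [exact: w0|rewrite M0E].
by apply: eq_bigr => k _; rewrite /m /M.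
Qed.

End TypeIIFormula.

(** * The logarithmic derivative is a rational function *)

Section PolyLemmas.
Context {R : realType}.

Lemma poly_eq0_on_itv (p : {poly R}) (a b : R) : a < b ->
  (forall s, a < s < b -> p.[s] = 0) -> p = 0.
Proof.
move=> ab pab; apply/eqP/negPn/negP => p0.
pose t i := a + (b - a) / i.+2%:R.
have i0 i : 0 < i.+2%:R :> R by rewrite ltr0n.
have ti i : a < t i < b.
  rewrite /t ltrDl divr_gt0 ?subr_gt0//= -ltrBrDl ltr_pdivrMr//.
  by rewrite ltr_pMr ?subr_gt0// ltr1n.
have t_inj : injective t.
  move=> i j /addrI /mulfI; rewrite gt_eqF ?subr_gt0// => /(_ isT) /invr_inj /eqP.
  by rewrite eqr_nat => /eqP [].
have := max_poly_roots (rs := mkseq t (size p)) p0.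
rewrite size_mkseq ltnn => H; suff : false by []; apply: H.
  by apply/allP => _ /mapP[i _ ->]; rewrite rootE pab.
exact: mkseq_uniq.
Qed.

Lemma poly_size2_factor (p : {poly R}) : p != 0 -> (size p <= 2)%N ->
  exists c rs, [/\ c != 0, (size rs <= 1)%N & p = c *: \prod_(z <- rs) ('X - z%:P)].
Proof.
move=> p0; rewrite leq_eqVlt => /orP[/eqP p2|].
  exists p`_1, [:: - p`_0 / p`_1].
  have p1 : p`_1 != 0 by have := p0; rewrite -lead_coef_eq0 lead_coefE p2.
  split => //; rewrite big_seq1; apply/polyP => -[|[|i]].
  - by rewrite coefZ coefB coefX coefC /= sub0r mulNr opprK mulrC divfK.
  - by rewrite coefZ coefB coefX coefC /= subr0 mulr1.
  - by rewrite coefZ coefB coefX coefC /= subr0 mulr0 nth_default// p2.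
rewrite ltnS => /size1_polyC pE; exists p`_0, [::]; split => //.
  by apply: contraNneq p0 => c0; rewrite pE c0.
by rewrite big_nil {1}pE alg_polyC.
Qed.

Lemma size_XnM (k : nat) (p : {poly R}) : p != 0 ->
  size ('X^k * p) = (k + size p)%N.
Proof. by move=> p0; rewrite size_monicM ?monicXn// size_polyXn. Qed.

End PolyLemmas.

Section LogDerivative.
Context {R : realType}.
Local Notation mu := (@lebesgue_measure R).
Variables (r : nat) (w : 'I_r -> R -> R) (n : nat) (om : R -> R).
Hypotheses (r_gt0 : (0 < r)%N) (rn : (r < n)%N).
Hypothesis w_type : forall mv : 'I_r -> nat, step_line mv ->
  (1 <= mi_norm mv <= n)%N -> additive_derivative_type (W_family w mv).
Hypothesis typ : additive_derivative_type_wrt (W_family w (@step_index r n)) om.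

Definition laplace_domain := [set s | forall j, locally_laplace_integrable (w j) s].
Local Notation J := laplace_domain.
Local Notation F := (Laplace om).
Local Notation W m := (W_family w (@step_index r m)).

Lemma W_domain mv i s : J s -> locally_laplace_integrable (W_family w mv i) s.
Proof. exact: locally_laplace_W. Qed.

Lemma W_integrable mv s : J s ->
  forall i, laplace_integrable (W_family w mv i) s.
Proof. by move=> Js i; apply: locally_laplace_at; exact: W_domain. Qed.

Lemma card_step m : #|{: {j : 'I_r & 'I_(step_index m j)}}| = m.
Proof. by rewrite card_W_family step_index_norm. Qed.

Lemma span_is_derive mv f s : in_span (W_family w mv) f -> J s ->
  is_derive s 1 (Laplace f) (- Laplace (fun x => x * f x) s).
Proof.
move=> [c cE] Js.
have cE' : {ae mu, forall x, x * f x = x * (\sum_i c i * W_family w mv i x)}.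
  by apply: ae_imp cE => x ->.
rewrite (Laplace_ae_eq cE) (Laplace_ae_eq cE').
by apply: is_derive_Laplace; apply: locally_laplace_sum => i; exact: W_domain.
Qed.

Lemma span_derive_continuous mv f s : in_span (W_family w mv) f -> J s ->
  derivable (Laplace f) s 1 /\ {for s, continuous (derive1 (Laplace f))}.
Proof.
move=> [c cE] Js; rewrite (Laplace_ae_eq cE).
set g := fun x => _.
have gJ t : J t -> locally_laplace_integrable g t.
  by move=> Jt; apply: locally_laplace_sum => i; exact: W_domain.
split; first by case: (is_derive_Laplace (gJ s Js)).
have gJ2 := is_derive_Laplace (locally_laplace_pow 1 (gJ s Js)).
have cont : {for s, continuous (fun t => - Laplace (fun x => x ^+ 1 * g x) t)}.
  apply: continuousN; apply: differentiable_continuous; apply/derivable1_diffP.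
  by case: gJ2.
have near_eq : \forall t \near s, - Laplace (fun x => x ^+ 1 * g x) t = derive1 (Laplace g) t.
  have : nbhs s J by apply: open_nbhs_nbhs; split => //; exact: open_locally_laplace.
  apply: filterS => t Jt.
  by case: (is_derive_Laplace (gJ t Jt)) => _; rewrite derive1E => ->.
suff H : derive1 (Laplace g) t @[t --> s] --> derive1 (Laplace g) s by exact: H.
rewrite -(nbhs_singleton near_eq).
by apply: cvg_trans cont; apply: near_eq_cvg; exact: near_eq.
Qed.

Variables (a b : R).
Hypotheses (ab : a < b) (F0 : forall s, a < s < b -> J s /\ F s != 0).

Definition represents f (p : {poly R}) := forall s, J s -> Laplace f s = p.[s] * F s.

(** On the interval where [F] does not vanish, [p * F] determines infinitely many
    values of [p]. *)
Lemma horner_mul_inj (p q : {poly R}) :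
  (forall s, J s -> p.[s] * F s = q.[s] * F s) -> p = q.
Proof.
move=> pq; apply/eqP; rewrite -subr_eq0; apply/eqP.
apply: (poly_eq0_on_itv ab) => s sab; have [Js Fs] := F0 sab.
by rewrite hornerD hornerN; apply: (mulIf Fs); rewrite mul0r mulrBl pq// subrr.
Qed.

Lemma represents_inj f p q : represents f p -> represents f q -> p = q.
Proof. by move=> fp fq; apply: horner_mul_inj => s Js; rewrite -fp// fq. Qed.

Lemma represents_sum (I : finType) (c : I -> R) (u : I -> R -> R) p f :
  (forall i s, J s -> laplace_integrable (u i) s) ->
  (forall i, represents (u i) (p i)) ->
  {ae mu, forall x, f x = \sum_i c i * u i x} ->
  represents f (\sum_i c i *: p i).
Proof.
move=> ui up fE s Js; rewrite (Laplace_ae_eq fE) Laplace_sum => [|i]; last exact: ui.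
rewrite horner_sum mulr_suml; apply: eq_bigr => i _.
by rewrite up// hornerZ mulrA.
Qed.

Lemma span_represents m om' p f : additive_derivative_type_wrt (W m) om' ->
  represents om' p -> in_span (W m) f ->
  exists2 q : {poly R}, (size q <= m)%N & represents f (q * p).
Proof.
move=> typ' omp /(span_Laplace typ')[q]; rewrite card_step => qm fq.
exists q => // s Js; rewrite fq; last exact: W_integrable.
by rewrite omp// hornerM mulrA.
Qed.

Lemma derivn_represents m om' p j : additive_derivative_type_wrt (W m) om' ->
  represents om' p -> (j < m)%N -> represents (derive1n j om') ('X^j * p).
Proof.
move=> typ' omp jm s Js; rewrite (type_Laplace typ') ?card_step//.
  by rewrite omp// hornerM hornerXn mulrA.
exact: W_integrable.
Qed.

Lemma om_represents : represents om 1.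
Proof. by move=> s _; rewrite hornerC mul1r. Qed.

(** The polynomials representing the [n] members of the family span the space of
    polynomials of degree less than [n], since they generate its basis of
    monomials; hence they form a basis and none of them is zero. *)
Lemma W_represents_neq0 i p : represents (W n i) p -> p != 0.
Proof.
move=> ip; apply/negP => /eqP p0; rewrite {}p0 in ip.
pose I := {: {j : 'I_r & 'I_(step_index n j)}}.
have /choice[q qP] (k : I) : exists q, represents (W n k) q.
  have [q _] := span_represents typ om_represents (in_span_mem (W n) k).
  by rewrite mulr1; exists q.
have /choice[B BP] (j : 'I_#|I|) : exists d, {ae mu, forall x,
    derive1n j om x = \sum_k d k * W n k x}.
  exact: (type_in_span typ (ltn_ord j)).
have XE (j : 'I_#|I|) : 'X^j = \sum_k B j k *: q k.
  have h1 := represents_sum (fun k s Js => W_integrable Js k) qP (BP j).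
  have jn : (j < n)%N by move: (ltn_ord j); rewrite [X in (_ < X)%N]card_step.
  have := derivn_represents typ om_represents jn; rewrite mulr1 => h2.
  exact: represents_inj h2 h1.
(* [B'] expresses the monomials through the [q k] and [A] the [q k] through the
   monomials; a zero [q i] would be a zero row of the invertible [A]. *)
pose A : 'M[R]_#|I| := \matrix_(k, l) (q (enum_val k))`_l.
pose B' : 'M[R]_#|I| := \matrix_(j, k) B j (enum_val k).
have BA : B' *m A = 1%:M.
  apply/matrixP => j l; rewrite !mxE.
  under eq_bigr do rewrite !mxE.
  have -> : (j == l)%:R = (\sum_k B j k *: q k)`_l :> R.
    by rewrite -XE coefXn eq_sym.
  rewrite coef_sum (eq_bigl (mem I)) //.
  rewrite (big_enum_val (A := mem I) (fun k => (B j k *: q k)`_l)) /=.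
  by apply: eq_bigr => k _; rewrite coefZ.
have AB : A *m B' = 1%:M by exact: mulmx1C.
have qi0 : q i = 0 by exact: represents_inj (qP i) ip.
have := congr1 (fun M : 'M[R]_#|I| => M (enum_rank i) (enum_rank i)) AB.
rewrite !mxE eqxx big1 => [/eqP|k _]; first by rewrite eq_sym oner_eq0.
by rewrite !mxE enum_rankK qi0 coef0 mul0r.
Qed.

(** One step from [m + 1] down to [m]. The generator [om1] of the smaller family
    lies in the larger span, so its transform is [p * E' * F] for a polynomial [p].
    Its derivative of order [m - 1] lies there as well, so [X^(m-1) * p] has degree
    at most [m] and [p] has degree at most one, hence a real root or none. *)
Lemma downward_chain k : (k < n)%N -> exists om' c rs,
  [/\ additive_derivative_type_wrt (W (n - k)) om', c != 0, (size rs <= k)%N &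
      represents om' (c *: \prod_(z <- rs) ('X - z%:P))].
Proof.
elim: k => [|k ih] kn.
  exists om, 1, [::]; split => //; first by rewrite subn0.
  by rewrite big_nil scale1r; exact: om_represents.
have [om' [c [rs [typ' c0 rsk rep']]]] := ih (ltnW kn).
set E' := c *: _ in rep'.
have E'0 : E' != 0.
  by rewrite scaler_eq0 negb_or c0 /= prodf_seq_neq0; apply/allP => z _; rewrite /= polyXsubC_eq0.
pose m := (n - k.+1)%N.
have mE : (n - k)%N = m.+1 by rewrite /m subnSK// ltnW.
have m0 : (0 < m)%N by rewrite /m subn_gt0.
rewrite mE in typ'.
have [om1 typ1] : additive_derivative_type (W m).
  apply: w_type; first exact: step_index_step_line.
  by rewrite step_index_norm// m0 leq_subr.
have sub_mS f : in_span (W m) f -> in_span (W m.+1) f.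
  by apply: in_span_W_sub => j; apply: leq_step_index.
have [p pm prep] : exists2 p : {poly R}, (size p <= m.+1)%N & represents om1 (p * E').
  apply: (span_represents typ') => //; apply: sub_mS.
  by apply: (type_in_span typ1 (j := 0)); rewrite card_step.
have [u um urep] : exists2 p : {poly R}, (size p <= m.+1)%N &
    represents (derive1n m.-1 om1) (p * E').
  apply: (span_represents typ') => //; apply: sub_mS.
  by apply: (type_in_span typ1); rewrite card_step prednK.
have uE : u = 'X^(m.-1) * p.
  apply: (mulIf E'0); rewrite -mulrA; apply: represents_inj urep _.
  by apply: (derivn_represents typ1 prep); rewrite prednK.
have p0 : p != 0.
  apply/negP => /eqP p0; rewrite p0 mul0r in prep.
  have : (0 < #|{: {j : 'I_r & 'I_(step_index m j)}}|)%N by rewrite card_step.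
  move=> /card_gt0P[i _].
  have [q _] := span_represents typ1 prep (in_span_mem (W m) i).
  rewrite mulr0 => i0.
  have le_m (j : 'I_r) : (step_index m j <= step_index n j)%N by apply: leq_step_index; exact: leq_subr.
  have [i' iE] := W_family_sub w le_m i.
  by rewrite iE in i0; have := W_represents_neq0 i0; rewrite eqxx.
have p2 : (size p <= 2)%N.
  by have := um; rewrite uE size_XnM// -{2}(prednK m0) -addn2 leq_add2l.
have [c' [rs' [c'0 rs'1 pE]]] := poly_size2_factor p0 p2.
exists om1, (c' * c), (rs' ++ rs); split => //.
- by rewrite mulf_neq0.
- by rewrite size_cat -add1n leq_add.
- by move: prep; rewrite pE /E' big_cat /= -scalerA -scalerAl -scalerAr.
Qed.

(** Multiplication by [x] maps the span for [n - r] into the span for [n] and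
    becomes [- d/ds] under the transform. For the generator [om'] this says that
    [(q * F)^`() = - G * F]; for its derivative of order [n - r - 1] it bounds the
    degree of [X^(n-r-1) * G], hence that of [G] by [r]. *)
Theorem log_derivative_fraction : exists (rs : seq R) (P : {poly R}),
  [/\ (size rs <= r)%N, (size P <= r.+1)%N & forall s, J s ->
    (\prod_(z <- rs) ('X - z%:P)).[s] * derive1 F s = P.[s] * F s].
Proof.
have [om' [c [rs [typ' c0 rsr rep']]]] := downward_chain rn.
set q0 := \prod_(z <- rs) _ in rep'; set q := c *: q0 in rep'.
pose m := (n - r)%N; rewrite -/m in typ'.
have m0 : (0 < m)%N by rewrite subn_gt0.
have nE : (m + r)%N = n by rewrite subnK// ltnW.
have mulx f : in_span (W m) f -> in_span (W n) (fun x => x * f x).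
  by apply: in_span_W_mulx => j; rewrite -nE step_indexDr.
have om'm : in_span (W m) om'.
  by apply: (type_in_span typ' (j := 0)); rewrite card_step.
pose f := derive1n m.-1 om'.
have fm : in_span (W m) f.
  by apply: (type_in_span typ'); rewrite card_step prednK.
have [G Gn Grep] := span_represents typ om_represents (mulx _ om'm).
have [H Hn Hrep] := span_represents typ om_represents (mulx _ fm).
rewrite mulr1 in Grep; rewrite mulr1 in Hrep.
have om_n : in_span (W n) om.
  by apply: (type_in_span typ (j := 0)); rewrite card_step; exact: leq_ltn_trans rn.
have dF s : J s -> is_derive s 1 F (derive1 F s).
  move=> Js; have [d _] := span_derive_continuous om_n Js.
  by split; [exact: d|rewrite derive1E].
have nbhsJ s : J s -> nbhs s J.
  by move=> Js; apply: open_nbhs_nbhs; split => //; exact: open_locally_laplace.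
have rel s : J s -> q.[s] * derive1 F s = (- G - q^`()).[s] * F s.
  move=> Js; have d1 := dF s Js; have d2 := span_is_derive om'm Js.
  have d3 : is_derive s 1 (horner q * F) (- Laplace (fun x => x * om' x) s).
    apply: near_eq_is_derive d2; near=> t; apply: rep'; near: t; exact: nbhsJ.
  clear d2; have d4 := is_deriveM (is_derive_poly q s) d1.
  have E : - (G.[s] * F s) = q.[s] * derive1 F s + F s * q^`().[s].
    by rewrite -Grep//; case: d3 => _ <-; case: d4 => _ ->.
  rewrite hornerD !hornerN mulrBl mulNr E; ring.
(* Differentiate [L f = X^(m-1) * q * F] and eliminate [F'] by [rel]. *)
have HE : - H = m.-1%:R *: ('X^(m.-2) * q) - 'X^(m.-1) * G.
  apply: horner_mul_inj => s Js.
  have d1 := dF s Js; have d2 := span_is_derive fm Js.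
  have repf : represents f ('X^(m.-1) * q).
    by apply: (derivn_represents typ' rep'); rewrite prednK.
  have d3 : is_derive s 1 (horner ('X^(m.-1) * q) * F) (- Laplace (fun x => x * f x) s).
    apply: near_eq_is_derive d2; near=> t; apply: repf; near: t; exact: nbhsJ.
  clear d2; have d4 := is_deriveM (is_derive_poly ('X^(m.-1) * q) s) d1.
  have E : - (H.[s] * F s) = ('X^(m.-1) * q).[s] * derive1 F s +
      F s * ('X^(m.-1) * q)^`().[s].
    by rewrite -Hrep//; case: d3 => _ <-; case: d4 => _ ->.
  rewrite hornerN mulNr E hornerM -mulrA rel// derivM derivXn.
  rewrite !(hornerD, hornerN, hornerM, hornerZ, hornerMn) -[('X^(m.-2)).[s] *+ _]mulr_natl.
  ring.
exists rs, (c^-1 *: (- G - q^`())); split => //.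
  apply: leq_trans (size_scale_leq _ _) _.
  have q_size : (size q <= r.+1)%N.
    by rewrite /q (leq_trans (size_scale_leq _ _))// size_prod_XsubC ltnS.
  apply: leq_trans (size_polyD _ _) _; rewrite !size_polyN geq_max; apply/andP; split.
    have GE : ('X^(m.-1) * G : {poly R}) = H + m.-1%:R *: ('X^(m.-2) * q).
      by rewrite -[H]opprK HE opprB subrK.
    have : (size ('X^(m.-1) * G : {poly R})%R <= n)%N.
      rewrite GE (leq_trans (size_polyD _ _))// geq_max Hn /=.
      case: (m) m0 nE => // -[|m'] _ nE'; first by rewrite scale0r size_poly0.
      apply: leq_trans (size_scale_leq _ _) _.
      apply: leq_trans (size_polyMleq _ _) _; rewrite size_polyXn /=.
      by rewrite -nE' !addSn -addnS; apply: leqW; rewrite leq_add2l.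
    have [->|G0] := eqVneq G 0; first by rewrite size_poly0.
    by rewrite size_XnM// -nE -{2}(prednK m0) addSnnS leq_add2l.
  by apply: leq_trans (size_poly _ _) _; apply: leq_trans (leq_pred _) q_size.
move=> s Js; rewrite hornerZ -mulrA -rel// /q hornerZ !mulrA mulVf// mul1r.
by [].
Unshelve. all: by end_near. Qed.

End LogDerivative.

(** * Roots of the denominator inside the interval *)

Section RootCancellation.
Context {R : realType}.
Variables (F dF : R -> R) (J Sigma : set R).
Hypotheses (J_derive : forall s, J s -> is_derive s 1 F (dF s))
  (J_cont : forall s, J s -> {for s, continuous dF})
  (Sigma_gt0 : Sigma `<=` [set s | 0 < s])
  (Sigma_J : forall s t, Sigma s -> 0 < t < s -> J t)
  (Sigma_left : forall s, Sigma s -> F t @[t --> s^'-] --> F s)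
  (Sigma_neq0 : forall s, Sigma s -> F s <> 0).

Definition log_derivative_relation (q P : {poly R}) :=
  forall s, J s -> q.[s] * dF s = P.[s] * F s.

Lemma near_left_ex (A : R -> Prop) (z : R) : (\forall t \near z^'-, A t) ->
  exists2 u, u < z & forall t, u < t < z -> A t.
Proof.
move=> [e /= e0 H]; exists (z - e); first by rewrite ltrBlDr ltrDl.
move=> t /andP[ut tz]; apply: H => //=.
by rewrite ger0_norm ?subr_ge0 ?ltW//; lra.
Qed.

Lemma F_continuous s : J s -> {for s, continuous F}.
Proof.
move=> Js; apply: differentiable_continuous; apply/derivable1_diffP.
by case: (J_derive Js).
Qed.

Lemma horner_cvg_left (p : {poly R}) (z : R) : p.[t] @[t --> z^'-] --> p.[z].
Proof. by apply: cvg_at_left_filter; exact: continuous_horner. Qed.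

(** Otherwise [|F'|] exceeds a multiple of [1 / (z - s)] to the left of [z]. By
    the mean value theorem the increment of [F] from [t] to the midpoint of [t]
    and [z] then stays away from zero as [t] tends to [z], although [F] is left
    continuous at [z]. This covers an endpoint [z] of [Sigma], where [F] need not
    be differentiable. *)
Lemma pole_not_in_Sigma q P z : log_derivative_relation q P -> Sigma z ->
  root q z -> root P z.
Proof.
move=> rel Sz /factor_theorem[q' qE]; rewrite rootE; apply/negPn/negP => Pz.
have z0 : 0 < z := Sigma_gt0 Sz.
pose c := `|P.[z] * F z|.
have c0 : 0 < c by rewrite normr_gt0 mulf_neq0//; apply/eqP; exact: Sigma_neq0.
pose K := `|q'.[z]| + 1.
have K0 : 0 < K by rewrite ltr_wpDl.
have cP : `|P.[t] * F t| @[t --> z^'-] --> c.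
  by apply: cvg_norm; apply: cvgM; [exact: horner_cvg_left|exact: Sigma_left].
have cq : `|q'.[t]| @[t --> z^'-] --> `|q'.[z]|.
  by apply: cvg_norm; exact: horner_cvg_left.
(* Both [F t] and [F t'] are within this distance of [F z]. *)
have e0 : 0 < c / (16 * K) by rewrite divr_gt0// mulr_gt0.
have [u uz Hu] : exists2 u, u < z & forall t, u < t < z ->
    [/\ c / 2 < `|P.[t] * F t|, `|q'.[t]| < K, `|F z - F t| < c / (16 * K) & 0 < t].
  apply: near_left_ex; near=> t; split.
  - by near: t; apply: (cvgr_gt c cP); rewrite ltr_pdivrMr// ltr_pMr// ltr1n.
  - by near: t; apply: (cvgr_lt `|q'.[z]| cq); rewrite ltrDl.
  - near: t; have /cvgrPdist_lt H := Sigma_left Sz; exact: H.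
  - by near: t; exact: nbhs_left_gt.
pose t := (u + z) / 2; pose t' := (t + z) / 2.
have ut : u < t by rewrite /t; lra.
have tt' : t < t' by rewrite /t' /t; lra.
have t'z : t' < z by rewrite /t' /t; lra.
have [_ _ h1 t0] := Hu t ltac:(rewrite ut (lt_trans tt')//).
have [_ _ h2 _] := Hu t' ltac:(rewrite t'z (lt_trans ut)//).
have inJ x : t <= x <= t' -> J x.
  move=> /andP[tx xt']; apply: (Sigma_J Sz).
  by rewrite (lt_le_trans t0)//= (le_lt_trans xt').
have derF x : x \in `]t, t'[ -> is_derive x 1 F (dF x).
  by rewrite in_itv /= => /andP[/ltW tx /ltW xt']; apply/J_derive/inJ; rewrite tx.
have cF : {within `[t, t'], continuous F}.
  by apply: continuous_in_subspaceT => x /set_mem; rewrite /= in_itv /= => /inJ; exact: F_continuous.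
have [x + E] := MVT tt' derF cF; rewrite in_itv /= => /andP[tx xt'].
have [h3 h4 _ _] := Hu x ltac:(rewrite (lt_trans ut tx) (lt_trans xt')//).
have Jx : J x by apply: inJ; rewrite !ltW.
have relx := rel x Jx; rewrite qE hornerM hornerXsubC in relx.
have xz : 0 < z - x by rewrite subr_gt0 (lt_trans xt').
have h5 : c / 2 < K * (z - x) * `|dF x|.
  apply: (lt_le_trans h3); rewrite -relx !normrM (distrC x) (gtr0_norm xz).
  by rewrite ler_wpM2r// ler_wpM2r ?ltW.
have h6 : `|F t' - F t| = `|dF x| * (t' - t).
  by rewrite E normrM (gtr0_norm (_ : 0 < t' - t)) ?subr_gt0.
have h7 : `|F t' - F t| < c / (8 * K).
  have -> : F t' - F t = (F z - F t) - (F z - F t') by ring.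
  apply: (le_lt_trans (ler_normB _ _)).
  have -> : c / (8 * K) = c / (16 * K) + c / (16 * K) by field; rewrite gt_eqF.
  exact: ltrD.
have h8 : z - x <= 2 * (t' - t) by rewrite /t'; lra.
have h9 : c / (8 * K) * (4 * K) = c / 2 by field; rewrite gt_eqF.
have h10 : K * (z - x) * `|dF x| <= `|F t' - F t| * (4 * K).
  rewrite h6; have := ler_wpM2r (normr_ge0 (dF x)) (ler_wpM2l (ltW K0) h8).
  move/le_trans; apply.
  have -> : `|dF x| * (t' - t) * (4 * K) = 2 * (K * (2 * (t' - t)) * `|dF x|) by ring.
  rewrite ler_peMl ?ler1n// mulr_ge0// mulr_ge0 ?(ltW K0)// mulr_ge0// subr_ge0 ltW//.
have K40 : 0 < 4 * K by rewrite mulr_gt0.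
have := h7; rewrite -(ltr_pM2r K40) h9 => h11.
by have := lt_trans (lt_le_trans h5 h10) h11; rewrite ltxx.
Unshelve. all: by end_near. Qed.

(** At [s = z] itself the factor cannot be divided out, and the relation follows
    by continuity. *)
Lemma cancel_Sigma_root q P z : Sigma z ->
  log_derivative_relation (q * ('X - z%:P)) (P * ('X - z%:P)) ->
  log_derivative_relation q P.
Proof.
move=> Sz rel.
have off s : J s -> s != z -> q.[s] * dF s = P.[s] * F s.
  move=> Js sz; have := rel s Js; rewrite !hornerM hornerXsubC.
  by rewrite -!(mulrAC _ _ (s - z)) => /mulIf; apply; rewrite subr_eq0.
move=> s Js; have [sz|] := eqVneq s z; last exact: off.
rewrite sz in Js *; apply/eqP; rewrite -subr_eq0; apply/eqP.
pose h t := q.[t] * dF t - P.[t] * F t.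
have c1 : h t @[t --> z^'-] --> h z.
  apply: cvg_at_left_filter; apply: cvgB; apply: cvgM; try exact: continuous_horner.
    exact: J_cont.
  exact: F_continuous.
have c2 : h t @[t --> z^'-] --> 0.
  apply: cvg_near_cst; near=> t.
  have tz : t < z by near: t; exact: nbhs_left_lt.
  have t0 : 0 < t by near: t; apply: nbhs_left_gt; exact: Sigma_gt0.
  by rewrite /h off ?subrr// ?lt_eqF//; apply: (Sigma_J Sz); rewrite t0.
exact: cvg_unique c1 c2.
Unshelve. all: by end_near. Qed.

Lemma cancel_Sigma_roots (rs : seq R) (P : {poly R}) :
  log_derivative_relation (\prod_(z <- rs) ('X - z%:P)) P ->
  exists (rs' : seq R) (P' : {poly R}),
  [/\ (size rs' <= size rs)%N, (size P' <= size P)%N,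
      log_derivative_relation (\prod_(z <- rs') ('X - z%:P)) P' &
      forall z, z \in rs' -> ~ Sigma z].
Proof.
have [k] := ubnP (size rs); elim: k rs P => // k ih rs P rsk rel.
have [[z zrs Sz]|noS] := pselect (exists2 z, z \in rs & Sigma z); last first.
  by exists rs, P; split => // z zrs Sz; apply: noS; exists z.
have qE : \prod_(x <- rs) ('X - x%:P) = \prod_(x <- rem z rs) ('X - x%:P) * ('X - z%:P).
  by rewrite (perm_big _ (perm_to_rem zrs)) big_cons mulrC.
have qz : root (\prod_(x <- rs) ('X - x%:P)) z by rewrite root_prod_XsubC.
have /factor_theorem[P1 PE] := pole_not_in_Sigma rel Sz qz.
rewrite qE PE in rel.
have [|rs' [P' [h1 h2 h3 h4]]] := ih (rem z rs) P1 _ (cancel_Sigma_root Sz rel).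
  by rewrite size_rem//; move: zrs rsk; case: (rs).
exists rs', P'; split => //.
  by apply: (leq_trans h1); rewrite size_rem// leq_pred.
apply: (leq_trans h2); rewrite PE.
have [->|P10] := eqVneq P1 0; first by rewrite size_poly0.
by rewrite size_Mmonic ?monicXsubC// size_XsubC addn2 /=.
Qed.

End RootCancellation.

(** * Integrating a logarithmic derivative *)

Section LogIntegral.
Context {R : realType}.
Local Notation mu := (@lebesgue_measure R).

Lemma continuous_integrable_itv (a b : R) (g : R -> R) :
  {within `[a, b], continuous g} -> mu.-integrable `[a, b] (EFin \o g).
Proof.
by move=> cg; apply: continuous_compact_integrable => //; exact: segment_compact.
Qed.

Lemma no_zero_same_sign (a b : R) (h : R -> R) : a <= b ->
  {within `[a, b], continuous h} -> (forall t, a <= t <= b -> h t != 0) ->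
  forall t, a <= t <= b -> 0 < h t / h a.
Proof.
move=> ab ch h0 t /andP[at' tb].
have a0 : h a != 0 by apply: h0; rewrite lexx.
have t0 : h t != 0 by apply: h0; rewrite at'.
rewrite lt0r mulf_neq0 ?invr_eq0//= leNgt; apply/negP => neg.
have prod_neg : h t * h a < 0.
  have -> : h t * h a = h t / h a * h a ^+ 2 by rewrite expr2 mulrA divfK.
  by rewrite nmulr_rlt0// lt0r sqrf_eq0 a0 sqr_ge0.
have ch' : {within `[a, t], continuous h}.
  by apply: continuous_subspaceW ch; apply: subset_itvl; rewrite bnd_simp.
have [|c cat hc] := IVT at' ch' (v := 0).
  have [ha|ha|ha] := ltgtP (h a) 0.
  - have ht : 0 < h t by rewrite -(nmulr_llt0 _ ha).
    by rewrite ge_min le_max (ltW ha) (ltW ht) orbT.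
  - have ht : h t < 0 by rewrite -(pmulr_llt0 _ ha).
    by rewrite ge_min le_max (ltW ha) (ltW ht) orbT.
  - by rewrite ha eqxx in a0.
move: cat; rewrite in_itv /= => /andP[ac ct].
by have := h0 c; rewrite ac (le_trans ct tb) hc eqxx => /(_ isT).
Qed.

(** Apply the fundamental theorem to [ln (h t / h a)], defined because [h] keeps
    its sign. *)
Lemma log_derivative_integral (a b : R) (h g : R -> R) : a < b ->
  {within `[a, b], continuous h} -> {within `[a, b], continuous g} ->
  (forall t, a <= t <= b -> h t != 0) ->
  (forall t, a < t < b -> is_derive t 1 h (h t * g t)) ->
  0 < h b / h a /\ expR (\int[mu]_(t in `[a, b]) g t) = h b / h a.
Proof.
move=> ab ch cg h0 dh; have ab' := ltW ab.
have pos := no_zero_same_sign ab' ch h0.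
have pb : 0 < h b / h a by apply: pos; rewrite ab' lexx.
have a0 : h a != 0 by apply: h0; rewrite lexx.
split => //; pose L t := ln (h t / h a).
have [_ ca cb] := (continuous_within_itvP h ab).1 ch.
have dL t : a < t < b -> is_derive t 1 L (g t).
  move=> /[dup] tab /andP[/ltW at' /ltW tb].
  have tpos : 0 < h t / h a by apply: pos; rewrite at'.
  have d1 : is_derive t 1 (fun t => h t / h a) (h t * g t / h a).
    have d := dh t tab.
    have -> : (fun t => h t / h a) = (h a)^-1 \*: h.
      by apply/funext => x; rewrite /= /GRing.scale /= mulrC.
    by apply: is_derive_eq; rewrite /GRing.scale /= mulrC.
  have d2 := is_derive1_ln tpos.
  have d3 : is_derive t 1 (@ln R \o (fun t => h t / h a)) ((h t / h a)^-1 * (h t * g t / h a)).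
    exact: is_derive1_comp.
  apply: is_derive_eq d3 _; have := h0 t; rewrite at' tb => /(_ isT) t0.
  by field; rewrite a0 t0.
have cont_ln (x : R) : 0 < x -> {for x, continuous (@ln R)} by exact: continuous_ln.
have E : (\int[mu]_(x in `[a, b]) (g x)%:E = (L b)%:E - (L a)%:E)%E.
  apply: (continuous_FTC2 ab cg).
    split.
    - by move=> x; rewrite in_itv /= => /dL [].
    - rewrite /L; apply: continuous_cvg; first by apply: cont_ln; apply: pos; rewrite lexx.
      by apply: cvgM => //; exact: cvg_cst.
    - rewrite /L; apply: continuous_cvg; first exact: cont_ln.
      by apply: cvgM => //; exact: cvg_cst.
  by move=> x; rewrite in_itv /= => /dL [_ <-]; rewrite derive1E.
rewrite /Rintegral E -EFinB /= /L divff// ln1 subr0 lnK//.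
Qed.

End LogIntegral.

(** * The closed form *)

Section RationalFactorization.
Context {R : realType}.
Local Open Scope complex_scope.

(** The zero polynomial becomes [0] times an empty product, which lets the
    constant of the final formula vanish. *)
Lemma complex_linear_factors (r : nat) (N : {poly R}) : (size N <= r.+1)%N ->
  exists (c : R) (N0 : {poly R}) (a : 'I_r -> R[i]) (d1 : 'I_r -> bool),
  [/\ N = c *: N0,
      forall t : R, \prod_i (t%:C + a i) ^+ d1 i = (N0.[t])%:C &
      size N = r.+1 -> forall i, d1 i].
Proof.
move=> Nr; have [N_0|N_neq0] := eqVneq N 0.
  exists 0, 1, (fun=> 0), (fun=> false); split.
  - by rewrite scale0r.
  - by move=> t; rewrite hornerC big1.
  - by rewrite N_0 size_poly0.
pose c := lead_coef N; have c0 : c != 0 by rewrite lead_coef_eq0.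
pose N0 := c^-1 *: N.
have lN0 : lead_coef N0 = 1 by rewrite lead_coefZ mulVf.
have sN0 : size N0 = size N by rewrite size_scale// invr_eq0.
pose p := map_poly (real_complex R) N0.
have [as_ asE] := closed_field_poly_normal p.
have lp : lead_coef p = 1 by rewrite lead_coef_map lN0 rmorph1.
have sp : size p = size N by rewrite size_map_poly sN0.
rewrite lp scale1r in asE.
have sas : size N = (size as_).+1 by rewrite -sp asE size_prod_XsubC.
exists c, N0, (fun i => - nth 0 as_ i), (fun i => (i < size as_)%N); split.
- by rewrite /N0 scalerA mulfV// scale1r.
- move=> t; transitivity p.[t%:C]; last by rewrite /p horner_map.
  rewrite asE horner_prod (big_nth 0) big_mkord.
  have sr : (size as_ <= r)%N by rewrite -ltnS -sas.
  rewrite (big_ord_widen r (fun i => ('X - (nth 0 as_ i)%:P).[t%:C]) sr).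
  rewrite [RHS]big_mkcond /=; apply: eq_bigr => i _.
  by case: ifP => _; rewrite ?expr0// expr1 hornerXsubC.
- by move=> sN i; rewrite -ltnS -sas sN ltnS.
Qed.

Section LinearFactors.
Variables (r : nat) (rs : seq R).
Hypothesis rsr : (size rs <= r)%N.

Definition has_factor (i : 'I_r) := (i < size rs)%N.
(** Indexing the factors by ['I_r], with [1] in the unused places, matches the
    products of the final formula. *)
Definition padded_factor (i : 'I_r) : {poly R} :=
  if has_factor i then 'X - (nth 0 rs i)%:P else 1.

Lemma prod_padded_factor : \prod_(z <- rs) ('X - z%:P) = \prod_i padded_factor i.
Proof.
rewrite (big_nth 0) big_mkord.
by rewrite (big_ord_widen r (fun i => 'X - (nth 0 rs i)%:P) rsr) big_mkcond.
Qed.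

Lemma padded_factor_neq0 i : padded_factor i != 0.
Proof.
by rewrite /padded_factor; case: ifP => _; rewrite ?polyXsubC_eq0 ?oner_eq0.
Qed.

Lemma size_prod_other i : has_factor i ->
  (size (\prod_(j | j != i) padded_factor j)%R <= size rs)%N.
Proof.
move=> hi; have := size_prod_XsubC rs id; rewrite prod_padded_factor (bigD1 i)//=.
set q := \prod_(j | _) _; rewrite {1}/padded_factor hi mulrC size_Mmonic ?monicXsubC//.
  by rewrite size_XsubC addn2 /= => -[->].
by rewrite /q; apply/prodf_neq0 => j _; exact: padded_factor_neq0.
Qed.

Lemma deriv_padded_factor i : (padded_factor i)^`() = (has_factor i)%:R.
Proof.
by rewrite /padded_factor; case: ifP => _; rewrite ?derivXsubC// derivC.
Qed.

Lemma log_derivative_prod (m : 'I_r -> nat) (t : R) :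
  (forall i, (padded_factor i).[t] != 0) ->
  let H := \prod_i padded_factor i ^+ m i in
  H.[t] != 0 /\ H^`().[t] = H.[t] * \sum_i (has_factor i * m i)%:R / (padded_factor i).[t].
Proof.
move=> l0 /=; elim/big_ind2 : _ => [|p a q b [p0 pE] [q0 qE]|i _].
- by rewrite hornerC oner_eq0 derivC horner0 mulr0.
- by rewrite derivM hornerD !hornerM pE qE mulf_neq0//; split => //; ring.
rewrite horner_exp expf_neq0//; split => //.
rewrite deriv_exp hornerMn !hornerM deriv_padded_factor horner_exp.
have -> : (has_factor i)%:R.[t] = (has_factor i)%:R :> R.
  by case: (has_factor i); rewrite ?hornerC ?horner0.
case: (m i) => [|k]; first by rewrite mulr0n muln0 mul0r mulr0.
have := l0 i; set x := (padded_factor i).[t] => x0.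
by rewrite /= exprS natrM -mulr_natr; field.
Qed.

(** The numerator of [P / Q + \sum_i m i / (s - z i)] over the denominator [Q]:
    multiplying [F] by [\prod_i (s - z i) ^+ m i] adds this sum to its
    logarithmic derivative. *)
Definition shifted_numerator (P : {poly R}) (m : 'I_r -> nat) : {poly R} :=
  P + \sum_i (has_factor i * m i)%:R *: \prod_(j | j != i) padded_factor j.

Lemma horner_shifted_numerator P m t : (forall i, (padded_factor i).[t] != 0) ->
  let Q := \prod_i padded_factor i in
  (shifted_numerator P m).[t] / Q.[t] =
  P.[t] / Q.[t] + \sum_i (has_factor i * m i)%:R / (padded_factor i).[t].
Proof.
move=> l0 Q; rewrite /shifted_numerator hornerD mulrDl; congr (_ + _).
rewrite horner_sum mulr_suml; apply: eq_bigr => i _.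
rewrite hornerZ -mulrA; congr (_ * _).
set q := \prod_(j | _) _.
have -> : Q = padded_factor i * q by rewrite /Q (bigD1 i).
rewrite hornerM.
have q0 : q.[t] != 0.
  by rewrite /q horner_prod; apply/prodf_neq0 => j _; exact: l0.
have := l0 i => li.
by field; rewrite q0 li.
Qed.

Lemma size_shifted_numerator_sum m :
  (size (\sum_i (has_factor i * m i)%:R *: \prod_(j | j != i) padded_factor j)%R
    <= size rs)%N.
Proof.
apply: (leq_trans (size_sum _ _ _)); apply/bigmax_leqP => i _.
have [hi|hi] := boolP (has_factor i).
  by apply: leq_trans (size_scale_leq _ _) _; exact: size_prod_other.
by rewrite mul0n scale0r size_poly0.
Qed.

Lemma size_shifted_numerator (P : {poly R}) m : (size P <= r.+1)%N ->
  (size (shifted_numerator P m) <= r.+1)%N.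
Proof.
move=> Pr; apply: leq_trans (size_polyD _ _) _; rewrite geq_max Pr.
by apply: leq_trans (size_shifted_numerator_sum m) _; exact: leqW.
Qed.

Lemma size_shifted_numerator_full (P : {poly R}) m : size P = r.+1 ->
  size (shifted_numerator P m) = r.+1.
Proof.
move=> Pr; rewrite size_polyDl Pr// ltnS.
by apply: leq_trans (size_shifted_numerator_sum m) _.
Qed.

End LinearFactors.

End RationalFactorization.

Section ClosedForm.
Context {R : realType}.
Local Notation mu := (@lebesgue_measure R).
Local Open Scope complex_scope.
Variables (F dF : R -> R) (J Sigma : set R).
Hypotheses (J_derive : forall s, J s -> is_derive s 1 F (dF s))
  (Sigma_itv : is_interval Sigma)
  (Sigma_gt0 : Sigma `<=` [set s | 0 < s])
  (Sigma_J : forall s t, Sigma s -> 0 < t < s -> J t)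
  (Sigma_left : forall s, Sigma s -> F t @[t --> s^'-] --> F s)
  (Sigma_neq0 : forall s, Sigma s -> F s <> 0).

(** Inserting the factor [s + 1], whose root is not in [Sigma], in numerator and
    denominator until one of the two degrees is [r]. *)
Lemma pad_fraction (r : nat) (rs : seq R) (P : {poly R}) :
  (size rs <= r)%N -> (size P <= r.+1)%N ->
  log_derivative_relation F dF J (\prod_(z <- rs) ('X - z%:P)) P ->
  (forall z, z \in rs -> ~ Sigma z) ->
  exists (rs' : seq R) (P' : {poly R}),
  [/\ (size rs' <= r)%N, (size P' <= r.+1)%N,
      size rs' = r \/ size P' = r.+1,
      log_derivative_relation F dF J (\prod_(z <- rs') ('X - z%:P)) P' &
      forall z, z \in rs' -> ~ Sigma z].
Proof.
move=> rsr Pr rel noS.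
pose k := (r - maxn (size rs) (size P).-1)%N.
have kr : (maxn (size rs) (size P).-1 + k = r)%N.
  by rewrite subnKC// geq_max rsr -subn1 leq_subLR add1n.
have krs : (size rs + k <= r)%N by rewrite -[leqRHS]kr leq_add2r leq_maxl.
have kP : ((size P).-1 + k <= r)%N by rewrite -[leqRHS]kr leq_add2r leq_maxr.
pose P' := P * ('X - (-1)%:P) ^+ k.
have sP' : P != 0 -> size P' = (size P + k)%N.
  move=> P0; rewrite size_Mmonic ?monic_exp ?monicXsubC// size_exp_XsubC.
  by rewrite addnS.
exists (rs ++ nseq k (-1)), P'; split.
- by rewrite size_cat size_nseq.
- have [P0|P0] := eqVneq P 0; first by rewrite /P' P0 mul0r size_poly0.
  by rewrite sP'// -(prednK (_ : 0 < size P)%N) ?size_poly_gt0// addSn ltnS.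
- rewrite size_cat size_nseq; have [le1|le2] := leqP (size P).-1 (size rs).
    by left; rewrite -[RHS]kr (maxn_idPl le1).
  right; have P0 : P != 0 by apply: contraTneq le2 => ->; rewrite size_poly0.
  rewrite sP'// -(prednK (_ : 0 < size P)%N) ?size_poly_gt0// addSn.
  by rewrite -[in RHS]kr (maxn_idPr (ltnW le2)).
- move=> s Js; rewrite big_cat /= big_nseq iter_mulr_1 /P' !hornerM mulrAC rel//.
  by rewrite mulrAC.
- move=> z; rewrite mem_cat => /orP[/noS//|/nseqP[-> _] /Sigma_gt0 /=].
  by rewrite ltNge lerN10.
Qed.

(** The function [Phi = F * \prod_i (s + b i) ^+ (d2 i * nv i)] has logarithmic
    derivative [N / Q], where the roots of [Q] are the [- b i] with [d2 i] and those
    of a nonzero [N] are the [- a i] with [d1 i].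
    If [P] has degree [r], so has [N], because the sum added to [P] has smaller
    degree; thus the degree reached by padding survives. *)
Theorem log_derivative_closed_form (r : nat) (nv : 'I_r -> nat) (rs : seq R)
    (P : {poly R}) : (size rs <= r)%N -> (size P <= r.+1)%N ->
  log_derivative_relation F dF J (\prod_(z <- rs) ('X - z%:P)) P ->
  (forall z, z \in rs -> ~ Sigma z) ->
  exists (kappa : R) (a : 'I_r -> R[i]) (b : 'I_r -> R) (c s0 : R)
          (d1 d2 : 'I_r -> bool),
     [/\ kappa <> 0,
         (forall i, d1 i) \/ (forall i, d2 i) &
         forall s, Sigma s ->
           c_integrable_between s0 s (rational_product a b d1 d2) /\
           (kappa * F s)%:C =
             cexp (c%:C *
                   c_oriented_integral s0 s (rational_product a b d1 d2)) *
             (\prod_i (s%:C + (b i)%:C) ^+ (d2 i * nv i))^-1].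
Proof.
move=> rsr Pr rel noS.
have [{}rs [{}P [{}rsr {}Pr full {}rel {}noS]]] := pad_fraction rsr Pr rel noS.
rewrite (prod_padded_factor rsr) in rel.
pose ell (i : 'I_r) := padded_factor rs i; pose d2 (i : 'I_r) := has_factor rs i.
pose Q := \prod_i ell i; rewrite -/Q in rel.
pose N := shifted_numerator rs P nv.
have [c [N0 [a [d1 [NE aE d1E]]]]] :=
  complex_linear_factors (size_shifted_numerator rsr nv Pr).
have d12 : (forall i, d1 i) \/ (forall i, d2 i).
  case: full => [rsE|PE]; last by left; apply: d1E; exact: size_shifted_numerator_full.
  by right=> i; rewrite /d2 /has_factor rsE.
have [[s0 Ss0]|noSigma] := pselect (exists s, Sigma s); last first.
  exists 1, a, (fun=> 0), c, 0, d1, d2; split => // [|s Ss]; first by apply/eqP; rewrite oner_eq0.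
  by exfalso; apply: noSigma; exists s.
pose H := \prod_i ell i ^+ nv i.
have ell0 t i : Sigma t -> (ell i).[t] != 0.
  move=> St; rewrite /ell /padded_factor; case: ifP => [hi|_]; last by rewrite hornerC oner_eq0.
  rewrite hornerXsubC subr_eq0; apply/eqP => tz.
  by apply: (noS t) => //; rewrite tz mem_nth.
have H0 t : Sigma t -> H.[t] != 0.
  by move=> St; case: (log_derivative_prod nv (fun i => ell0 t i St)).
have Q0 t : Sigma t -> Q.[t] != 0.
  by move=> St; rewrite /Q horner_prod; apply/prodf_neq0 => i _; exact: ell0.
have FSigma t : Sigma t -> F t != 0 by move=> St; apply/eqP; exact: Sigma_neq0.
pose Phi t := F t * H.[t].
have Phi0 t : Sigma t -> Phi t != 0 by move=> St; rewrite mulf_neq0 ?FSigma ?H0.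
pose rho t := N.[t] / Q.[t]; pose rho0 t := N0.[t] / Q.[t].
have rhoE t : rho t = c * rho0 t by rewrite /rho /rho0 /N NE hornerZ mulrA.
have between s s' : Sigma s -> Sigma s' -> forall t, s <= t <= s' -> Sigma t.
  by move=> Ss Ss' t tss; exact: Sigma_itv tss.
have cont_poly (p : {poly R}) : continuous (horner p) by exact: continuous_horner.
have cont_rat (p : {poly R}) s s' : Sigma s -> Sigma s' ->
    {within `[s, s'], continuous (fun t => p.[t] / Q.[t])}.
  move=> Ss Ss'; apply: continuous_in_subspaceT => t /set_mem; rewrite /= in_itv /= => tss.
  apply: cvgM; first exact: cont_poly.
  by apply: cvgV; [apply: Q0; exact: between tss|exact: cont_poly].
have derPhi t : Sigma t -> J t -> is_derive t 1 Phi (Phi t * rho t).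
  move=> St Jt; have d := J_derive Jt.
  have dH := is_derive_poly H t.
  have [_ HE] := log_derivative_prod nv (fun i => ell0 t i St).
  have RE := horner_shifted_numerator P nv (fun i => ell0 t i St).
  have -> : Phi = F * horner H by [].
  apply: is_derive_eq; rewrite /GRing.scale /= [_^`().[t]]HE /rho [N.[t] / _]RE.
  have relt := rel t Jt; have Qt := Q0 t St.
  have -> : dF t = P.[t] / Q.[t] * F t.
    by apply: (mulfI Qt); rewrite relt mulrA mulrCA mulfV// mulr1.
  rewrite -/(H) -/(Q); set S := \sum_i _.
  have ringE (x y z v : R) : x * (y * z) + y * (v * x) = x * y * (v + z) by ring.
  exact: ringE.
have contPhi s s' : Sigma s -> Sigma s' -> s < s' -> {within `[s, s'], continuous Phi}.
  move=> Ss Ss' ss'.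
  have contF t : J t -> {for t, continuous F}.
    by move=> Jt; apply: differentiable_continuous; apply/derivable1_diffP; case: (J_derive Jt).
  have Js t : s <= t < s' -> J t.
    by move=> /andP[st ts']; apply: (Sigma_J Ss'); rewrite ts' (lt_le_trans (Sigma_gt0 Ss) st).
  apply/(continuous_within_itvP _ ss'); split.
  - move=> t; rewrite in_itv /= => /andP[/ltW st ts'].
    by apply: cvgM; [apply: contF; apply: Js; rewrite st|exact: cont_poly].
  - apply: cvg_at_right_filter; apply: cvgM; last exact: cont_poly.
    by apply: contF; apply: Js; rewrite lexx.
  - by apply: cvgM; [exact: Sigma_left|apply: cvg_at_left_filter; exact: cont_poly].
have forward s s' : Sigma s -> Sigma s' -> s < s' ->
    0 < Phi s' / Phi s /\ expR (\int[mu]_(t in `[s, s']) rho t) = Phi s' / Phi s.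
  move=> Ss Ss' ss'; apply: log_derivative_integral => //.
  - exact: contPhi.
  - exact: cont_rat.
  - by move=> t /(between _ _ Ss Ss'); exact: Phi0.
  - move=> t /andP[st ts']; apply: derPhi; first by apply: (between _ _ Ss Ss'); rewrite !ltW.
    by apply: (Sigma_J Ss'); rewrite ts' (lt_trans (Sigma_gt0 Ss) st).
have exp_rho s : Sigma s -> expR (oriented_integral s0 s rho) = Phi s / Phi s0.
  move=> Ss; rewrite /oriented_integral; case: (ltgtP s0 s) => [s0s|ss0|<-].
  - by have [_ ->] := forward _ _ Ss0 Ss s0s.
  - by have [_ E] := forward _ _ Ss Ss0 ss0; rewrite expRN E invf_div.
  - by rewrite set_itv1 Rintegral_set1 expR0 divff// Phi0.
have int_rho0 s s' : Sigma s -> Sigma s' -> mu.-integrable `[s, s'] (EFin \o rho0).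
  by move=> Ss Ss'; apply: continuous_integrable_itv; exact: cont_rat.
pose b (i : 'I_r) := - nth 0 rs i.
pose g := rational_product a b d1 d2.
have ellC t i : (t%:C + (b i)%:C) ^+ d2 i = ((ell i).[t])%:C.
  rewrite /ell /padded_factor -/(d2 i) /b; case: (d2 i).
    by rewrite expr1 hornerXsubC -rmorphD.
  by rewrite expr0 hornerC.
have gE t : g t = (rho0 t)%:C.
  rewrite /g /rational_product big_split /= aE prodfV.
  have -> : \prod_i (t%:C + (b i)%:C) ^+ d2 i = (Q.[t])%:C.
    by rewrite /Q horner_prod rmorph_prod /=; apply: eq_bigr => i _; exact: ellC.
  by rewrite /rho0 rmorphM /= fmorphV.
have HC s : (\prod_i (s%:C + (b i)%:C) ^+ (d2 i * nv i)) = (H.[s])%:C.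
  rewrite /H horner_prod rmorph_prod /=; apply: eq_bigr => i _.
  by rewrite exprM ellC horner_exp rmorphXn.
exists (Phi s0)^-1, a, b, c, s0, d1, d2; split => // [|s Ss].
  by apply/eqP; rewrite invr_eq0 Phi0.
have SminSmax : Sigma (Num.min s0 s) /\ Sigma (Num.max s0 s).
  by case: (leP s0 s).
have ReE : (fun t => complex.Re (g t)) = rho0 by apply/funext => t; rewrite gE.
have ImE : (fun t => complex.Im (g t)) = (fun=> 0) by apply/funext => t; rewrite gE.
split.
  rewrite /c_integrable_between; rewrite -/g ReE ImE; split.
    by case: SminSmax; exact: int_rho0.
  exact: integrable0.
rewrite /c_oriented_integral -/g ReE ImE HC.
have -> : oriented_integral s0 s (fun=> 0 : R) = 0.
  by rewrite /oriented_integral; case: ifP => _; rewrite Rintegral_cst// mul0r ?oppr0.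
have cI : c * oriented_integral s0 s rho0 = oriented_integral s0 s rho.
  rewrite /oriented_integral; case: ifP => [_|_].
    rewrite -RintegralZl//; last exact: int_rho0.
    by apply: eq_Rintegral => t _; rewrite rhoE.
  rewrite mulrN -RintegralZl//; last exact: int_rho0.
  by congr (- _); apply: eq_Rintegral => t _; rewrite rhoE.
have -> : c%:C * (oriented_integral s0 s rho0 +i* 0) = (oriented_integral s0 s rho)%:C.
  by rewrite -rmorphM /= cI.
rewrite /cexp /= cos0 sin0 mulr1 mulr0 exp_rho//.
rewrite -[_ +i* 0]/((Phi s / Phi s0)%:C) -fmorphV -rmorphM; congr (_%:C).
by rewrite mulrAC [in RHS]/Phi mulfK ?H0// mulrC.
Qed.

End ClosedForm.

(** * The theorem *)

Section NonzeroLaplace.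
Context {R : realType}.
Local Notation mu := (@lebesgue_measure R).

(** The positive and negative parts of a measurable function that is not
    integrable have an infinite integral for at least one of them; the difference
    is then infinite and its finite part is zero by convention. At an endpoint of
    [Sigma] integrability of [omega] is only available in this way. *)
Lemma Laplace_neq0_integrable (f : R -> R) (s : R) : measurable_fun setT f ->
  Laplace f s <> 0 -> laplace_integrable f s.
Proof.
move=> mf; pose k x := (f x * expR (- (s * x)))%:E.
have mk : measurable_fun setT k.
  by apply/measurable_EFinP; apply: measurable_funM => //; exact: measurable_expR_lin.
rewrite /Laplace /Rintegral -/k => nz.
have fin : (\int[mu]_x k x)%E \is a fin_num.
  by move: nz; rewrite -/k; case: (\int[mu]_x k x)%E.
have : (\int[mu]_x k^\+ x - \int[mu]_x k^\- x)%E \is a fin_num by rewrite -integralE.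
rewrite fin_numB => /andP[finp finn].
apply/integrableP; split => //.
have -> : (\int[mu]_x `|k x| = \int[mu]_x (k^\+ x + k^\- x))%E.
  by apply: eq_integral => x _; rewrite -[LHS]/((abse \o k) x) fune_abse.
rewrite ge0_integralD//; [|exact: measurable_funepos|exact: measurable_funeneg].
by rewrite lte_add_pinfty// ltey_eq ?finp ?finn.
Qed.

End NonzeroLaplace.

Local Open Scope complex_scope.

Theorem proposition5p8 (R : realType) (r n : nat) (Sigma : set R)
    (w : 'I_r -> R -> R) (nv : 'I_r -> nat) (omega : R -> R)
    (r_gt0 : (0 < r)%N) (n_gt0 : (0 < n)%N)
    (Sigma_itv : is_interval Sigma)
    (Sigma_gt0 : Sigma `<=` [set s | 0 < s])
    (w_L1 : forall j, L1_Laplace Sigma (w j))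
    (w_analytic : forall j, Laplace_analytic_at0 (w j))
    (w_type : forall mv : 'I_r -> nat, step_line mv ->
       (1 <= mi_norm mv <= n)%N -> additive_derivative_type (W_family w mv))
    (nv_step : step_line nv) (nv_norm : mi_norm nv = n)
    (omega_type : additive_derivative_type_wrt (W_family w nv) omega) :
  (forall P : {poly R},
     is_typeII_polynomial w nv P <->
     Laplace omega 0 <> 0 /\
     P = Laplace omega 0 *:
         \sum_(k < n.+1)
           ((-1) ^+ (n - k) * 'C(n, k)%:R *
            derive1n (n - k) (fun s => (Laplace omega s)^-1) 0) *: 'X^k) /\
  ((r < n)%N ->
   (forall s, Sigma s -> Laplace omega s <> 0) ->
   exists (kappa : R) (a : 'I_r -> R[i]) (b : 'I_r -> R) (c s0 : R)
          (d1 d2 : 'I_r -> bool),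
     [/\ kappa <> 0,
         (forall i, d1 i) \/ (forall i, d2 i) &
         forall s, Sigma s ->
           c_integrable_between s0 s (rational_product a b d1 d2) /\
           (Laplace (fun x => kappa * omega x) s)%:C =
             cexp (c%:C *
                   c_oriented_integral s0 s (rational_product a b d1 d2)) *
             (\prod_i (s%:C + (b i)%:C) ^+ (d2 i * nv i))^-1]).
Proof.
have w0 j : locally_laplace_integrable (w j) 0 by exact: Laplace_analytic_locally.
split; first by move=> P; exact: typeII_appell.
move=> rn Fneq0.
have [[sS SsS]|noSigma] := pselect (exists s, Sigma s); last first.
  exists 1, (fun=> 0), (fun=> 0), 0, 0, xpredT, xpredT; split => [||s Ss].
  - by apply/eqP; rewrite oner_eq0.
  - by left.
  - by exfalso; apply: noSigma; exists s.
have nvE : nv = @step_index r n.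
  apply: step_line_unique => //; first exact: step_index_step_line.
  by rewrite step_index_norm.
have typ := omega_type; rewrite nvE in typ.
have n2 : (2 <= n)%N by exact: leq_ltn_trans rn.
have m_om : measurable_fun setT omega.
  apply: continuous_measurable_fun; apply: (type_continuous typ (j := 0)).
  by rewrite card_step.
have om_span : in_span (W_family w (@step_index r n)) omega.
  by apply: (type_in_span typ (j := 0)); rewrite card_step.
have Sigma_J s t : Sigma s -> 0 < t < s -> laplace_domain w t.
  move=> Ss ts j; apply: locally_laplace_between ts _ _.
    exact: locally_laplace_at.
  exact: w_L1.
have J_om t : laplace_domain w t -> laplace_integrable omega t.
  move=> Jt; have [c cE] := om_span.
  apply: (@laplace_integrable_ae_eq _ (fun x => \sum_i c i * W_family w (@step_index r n) i x)) => //.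
    by apply: ae_imp cE.
  by apply: laplace_integrable_sum; exact: W_integrable.
have S_om s : Sigma s -> laplace_integrable omega s.
  by move=> Ss; apply: Laplace_neq0_integrable => //; exact: Fneq0.
have Sigma_left s : Sigma s -> Laplace omega t @[t --> s^'-] --> Laplace omega s.
  move=> Ss; have s0 : 0 < s := Sigma_gt0 s Ss.
  have s2 : s / 2 < s by rewrite ltr_pdivrMr// ltr_pMr// ltr1n.
  apply: (Laplace_left_continuous s2); last exact: S_om.
  by apply: J_om; apply: (Sigma_J s) => //; rewrite s2 divr_gt0.
(* Left continuity at a point of [Sigma] gives an interval where the transform of
   [omega] does not vanish, even if [Sigma] is a single point. *)
have [u usS Hu] : exists2 u, u < sS & forall t, u < t < sS ->
    laplace_domain w t /\ Laplace omega t != 0.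
  apply: near_left_ex; near=> t; split.
    apply: (Sigma_J sS) => //; apply/andP; split; last by near: t; exact: nbhs_left_lt.
    by near: t; apply: nbhs_left_gt; exact: Sigma_gt0.
  by near: t; apply: (cvgr_neq0 _ (Sigma_left sS SsS)); apply/eqP; exact: Fneq0.
have [rs [P [rsr Pr rel]]] := log_derivative_fraction r_gt0 rn w_type typ usS Hu.
have oJ : open (laplace_domain w) by exact: open_locally_laplace.
have J_derive s : laplace_domain w s ->
    is_derive s 1 (Laplace omega) (derive1 (Laplace omega) s).
  move=> Js; have [d _] := span_derive_continuous om_span Js.
  by split; [exact: d|rewrite derive1E].
have J_cont s : laplace_domain w s -> {for s, continuous (derive1 (Laplace omega))}.
  by move=> Js; have [_] := span_derive_continuous om_span Js.
have [rs' [P' [rsrs' PP' rel' noS]]] :=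
  cancel_Sigma_roots J_derive J_cont Sigma_gt0 Sigma_J Sigma_left Fneq0 rel.
have [kappa [a [b [c [s0 [d1 [d2 [k0 d12 H]]]]]]]] :=
  log_derivative_closed_form J_derive Sigma_itv Sigma_gt0 Sigma_J Sigma_left Fneq0
    nv (leq_trans rsrs' rsr) (leq_trans PP' Pr) rel' noS.
exists kappa, a, b, c, s0, d1, d2; split => // s Ss.
rewrite LaplaceZ; first exact: H.
exact: S_om.
Unshelve. all: by end_near. Qed.
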